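(* Let $s>3/2$ and let $u\in C([0,+\infty),H^s(\mathbb{S}))\cap C^1([0,+\infty),H^{s-1}(\mathbb{S}))$ be a global (real-valued) solution of the periodic Degasperis-Procesi equation $$u_t+uu_x+\partial_x p*\Bigl(\tfrac32 u^2\Bigr)=0,\qquad t>0,\ x\in\mathbb{S}.$$ If there exists a point $(t_0,x_0)\in[0,+\infty)\times\mathbb{S}$ such that $u(t_0,x_0)=0$, then $u(t,x)=0$ for all $(t,x)\in[0,+\infty)\times\mathbb{S}$.
   Context: $\mathbb{S}=\mathbb{R}/\mathbb{Z}$ is the circle of length $1$; functions on $\mathbb{S}$ are identified with $1$-periodic functions on $\mathbb{R}$, and $H^s(\mathbb{S})$ is the usual $L^2$-based Sobolev space (real-valued functions). For $s>3/2$ elements of $H^s(\mathbb{S})$ are identified with their $C^1$ representatives, so pointwise values make sense. The kernel $p$ is the kernel of $(1-\partial_x^2)^{-1}$ on $\mathbb{S}$, i.e. the continuous $1$-periodic function $$p(x)=\frac{\cosh(x-[x]-1/2)}{2\sinh(1/2)},$$ where $[x]$ is the integer part of $x$, and $*$ denotes convolution on $\mathbb{S}$ in the $x$ variable. The equation is the nonlocal reformulation of $u_t-u_{txx}+4uu_x=3u_xu_{xx}+uu_{xxx}$ with $u(t,x)=u(t,x+1)$. For every $u_0\in H^s(\mathbb{S})$, $s>3/2$, it is known that there exist $T>0$ and a unique solution $u\in C([0,T),H^s(\mathbb{S}))\cap C^1([0,T),H^{s-1}(\mathbb{S}))$ with $u(0,\cdot)=u_0$. A solution is global if it exists in this class on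 all of $[0,+\infty)$. *)

(* Defs.v *)
From HB Require Import structures.
From mathcomp Require Import all_boot all_order all_algebra.
From mathcomp Require Import all_classical all_reals all_analysis.

Set Implicit Arguments.
Unset Strict Implicit.
Unset Printing Implicit Defensive.

Import Order.TTheory GRing.Theory Num.Theory.
Import numFieldNormedType.Exports.

Local Open Scope classical_set_scope.
Local Open Scope ring_scope.

(* The circle R/Z: a function on it is a 1-periodic function on R, and its
   integral over the circle is the integral over [0, 1]. *)
Definition periodic1 (R : realType) (f : R -> R) : Prop :=
  forall x, f (x + 1) = f x.

Definition circle_conv (R : realType) (f g : R -> R) (x : R) : R :=
  \int[lebesgue_measure]_(y in `[0, 1]) (f (x - y) * g y).

Definition L2circle (R : realType) (f : R -> R) : Prop :=
  [/\ periodic1 f, measurable_fun setT f &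
      lebesgue_measure.-integrable `[0, 1] (fun x => (f x ^+ 2)%:E)].

(* For real-valued f, |hat f(k)|^2 where
   hat f(k) = int_0^1 f(x) exp(- 2 i pi k x) dx. *)
Definition fourier_sqmod (R : realType) (f : R -> R) (k : int) : R :=
  (\int[lebesgue_measure]_(x in `[0, 1]) (f x * cos (2 * pi * k%:~R * x))) ^+ 2
  + (\int[lebesgue_measure]_(x in `[0, 1])
       (f x * sin (2 * pi * k%:~R * x))) ^+ 2.

(* The square of the H^s norm, possibly +oo. *)
Definition sobolev_sqnorm (R : realType) (s : R) (f : R -> R) : \bar R :=
  \esum_(k in [set: int])
     (((1 + (2 * pi * k%:~R) ^+ 2) `^ s) * fourier_sqmod f k)%:E.

(* H^s(S) for s >= 0 (then H^s is a subspace of L^2), as a set of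
   representatives of classes modulo a.e. equality. *)
Definition sobolev (R : realType) (s : R) (f : R -> R) : Prop :=
  L2circle f /\ (sobolev_sqnorm s f < +oo)%E.

(* C([0, +oo), H^s(S)). *)
Definition C0_sobolev (R : realType) (s : R) (u : R -> R -> R) : Prop :=
  (forall t : R, 0 <= t -> sobolev s (u t)) /\
  (forall t : R, 0 <= t ->
     sobolev_sqnorm s (u r \- u t) @[r --> within `[0, +oo[ (nbhs t)]
       --> 0%E).

(* ut is the derivative of u as a map from [0, +oo) to H^s(S); at t = 0 the
   derivative is one-sided. *)
Definition sobolev_time_derivative (R : realType) (s : R)
    (u ut : R -> R -> R) : Prop :=
  forall t : R, 0 <= t ->
    sobolev_sqnorm s (fun x => (u r x - u t x) / (r - t) - ut t x)
      @[r --> within `[0, +oo[ t^'] --> 0%E.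

Definition C1fun (R : realType) (f : R -> R) : Prop :=
  (forall x : R, derivable f x 1) /\ continuous (derive1 f).

Definition sinh (R : realType) (x : R) : R := (expR x - expR (- x)) / 2.
Definition cosh (R : realType) (x : R) : R := (expR x + expR (- x)) / 2.

Definition kernel_p (R : realType) (x : R) : R :=
  cosh (x - (Num.floor x)%:~R - 1 / 2) / (2 * sinh (1 / 2)).

(* The equation u_t + u u_x + (p_x) * (3/2 u^2) = 0, where ut stands for u_t,
   holds a.e. in x, that is, as an equality in H^(s-1)(S).  The function
   kernel_p is not differentiable at the integers, where the value of its
   derive1 is meaningless; this null set does not affect the convolution. *)
Definition DP_equation (R : realType) (u ut : R -> R -> R) : Prop :=
  forall t : R, 0 < t ->
    {ae lebesgue_measure, forall x : R,
      ut t x + u t x * derive1 (u t) x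
      + circle_conv (derive1 (@kernel_p R)) (fun y => 3 / 2 * u t y ^+ 2) x = 0}.

(* u is a solution in C([0,+oo), H^s) /\ C^1([0,+oo), H^(s-1)), for s > 3/2;
   each u t is the C^1 representative of its class. *)
Definition DP_global_solution (R : realType) (s : R) (u : R -> R -> R) : Prop :=
  [/\ C0_sobolev s u,
      forall t : R, 0 <= t -> C1fun (u t) &
      exists ut : R -> R -> R,
        [/\ C0_sobolev (s - 1) ut,
            sobolev_time_derivative (s - 1) u ut &
            DP_equation u ut]].

(* Main.v *)
(* Let beta = 2. The kernels p + beta p' and p - beta p' are nonnegative on the
   circle because beta <= coth(1/2), and beta^2 >= 3/2. Hence, along the
   characteristics of u, the quantity min(-u_x - beta u, -u_x + beta u) grows at
   least like the solution of psi' = psi^2 as soon as it is positive, and would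
   blow up in finite time. A global solution therefore satisfies
   u_x >= - beta |u| everywhere. A periodic function with this property that
   vanishes somewhere is identically 0: to the right of a zero it stays
   nonnegative, so it is nonnegative, so exp(beta x) u is nondecreasing, and it
   vanishes at both ends of a period. Finally, the mean of u is conserved; if
   u(t0) = 0 then u(t) has mean 0 at every time t, hence a zero, hence is 0.

   Since u_x need not be differentiable in time, u_x is replaced by a difference
   quotient with a small fixed step h, for which the Riccati inequality holds up
   to an error that tends to 0 with h uniformly on compact time intervals.
   Pointwise control of u, u_x and u_t comes from the embedding of H^s into the
   continuous functions for s > 1/2, obtained from Fejer means. *)

Require Import Defs.
From mathcomp Require Import all_boot all_order all_algebra.
From mathcomp Require Import all_classical all_reals all_analysis.
From mathcomp Require Import measurable_realfun ring lra.

Import Order.TTheory GRing.Theory Num.Theory.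
Import numFieldNormedType.Exports.

Local Open Scope classical_set_scope.
Local Open Scope ring_scope.

Set Implicit Arguments.
Unset Strict Implicit.
Unset Printing Implicit Defensive.

(** * Real analysis *)

Section RealAnalysis.
Context {R : realType}.
Implicit Types (f g F : R -> R) (a b x y : R).

(** Continuity argument: at the supremum of the points up to which [P] holds, the third hypothesis
    gives [P] there and the second carries it further. Both barrier arguments below, one in time and
    one in space, are instances. *)
Lemma real_induction (P : R -> Prop) a b :
  P a ->
  (forall t, a <= t < b -> P t ->
     exists2 d : R, 0 < d & forall r, t < r < t + d -> P r) ->
  (forall t, a < t <= b -> (forall r, a <= r < t -> P r) -> P t) ->
  forall t, a <= t <= b -> P t.
Proof.
move=> Pa Pright Pleft t /andP[at_ tb].
pose S := [set x | a <= x <= b /\ forall r, a <= r <= x -> P r].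
have Sa : S a.
  split; first by rewrite lexx (le_trans at_ tb).
  by move=> r /andP[ar ra]; have -> : r = a by lra.
have ubS : ubound S b by move=> x [/andP[]].
have hS : has_sup S by split; [exists a|exists b].
have aS : a <= sup S by apply: ub_le_sup Sa; exists b.
have Sb : sup S <= b by apply: ge_sup => //; exists a.
have lP r : a <= r < sup S -> P r.
  move=> /andP[ar rS].
  have rS0 : 0 < sup S - r by lra.
  have [x [_ Px] rx] := sup_adherent rS0 hS.
  by apply: Px; rewrite ar ltW//; lra.
have PS : P (sup S).
  have [eS|nS] := eqVneq (sup S) a; first by rewrite eS.
  by apply: Pleft => //; rewrite lt_neqAle eq_sym nS aS Sb.
have lP' r : a <= r <= sup S -> P r.
  move=> /andP[ar]; rewrite le_eqVlt => /orP[/eqP->//|rS].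
  by apply: lP; rewrite ar rS.
have [Sltb|bS] := ltP (sup S) b; last by apply: lP'; lra.
have [||d d0 Pd] := Pright (sup S); [by rewrite aS Sltb|exact: PS|].
have m0 : sup S < Num.min (sup S + d / 2) b by rewrite lt_min Sltb andbT; lra.
suff : S (Num.min (sup S + d / 2) b).
  move=> /(ub_le_sup (ex_intro _ b ubS)) => h.
  by move: (lt_le_trans m0 h); rewrite ltxx.
split; first by rewrite ge_min lexx orbT andbT le_min (le_trans aS Sb) andbT; lra.
move=> r /andP[ar]; rewrite le_min => /andP[rd rb].
have [rS|Sr] := leP r (sup S); first by apply: lP'; rewrite ar rS.
by apply: Pd; lra.
Qed.

(** Compactness: a local threshold [n] serves every larger [m], so finitely many of them have a
    common bound. This turns local bounds, and local moduli of continuity coded as [1 / n], into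
    global ones. *)
Lemma locally_uniform_segment (Q : R -> R -> Prop) a b :
  (forall t, a <= t <= b -> exists2 d : R, 0 < d & exists n,
     forall m r, n <= m -> a <= r <= b -> `|r - t| < d -> Q m r) ->
  exists n, forall t, a <= t <= b -> Q n t.
Proof.
move=> Qloc.
have /compact_near_coveringP cov := @segment_compact R a b.
have : \forall n \near +oo, `[a, b] `<=` (fun t => a <= t <= b -> Q n t).
  apply: cov => t; rewrite /= in_itv/= => tab.
  have [d d0 [n Hn]] := Qloc t tab.
  exists (ball t d, [set m | n <= m]) => /=.
    split; first exact: nbhsx_ballx.
    by apply: nbhs_pinfty_ge; rewrite num_real.
  move=> [r m] /= [rd nm] rab; apply: Hn => //.
  by rewrite distrC.
move=> [n [_ Hn]]; exists (n + 1) => t tab.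
by apply: (Hn (n + 1)) => //; rewrite ?ltrDl//= in_itv.
Qed.

Lemma continuous_dist f x (e : R) : {for x, continuous f} -> 0 < e ->
  exists2 d : R, 0 < d & forall y, `|y - x| < d -> `|f y - f x| < e.
Proof.
move=> /cvgrPdist_lt fx e0.
have /nbhs_ballP[d d0 Hd] := fx _ e0.
exists d => // y yx; rewrite distrC; apply: Hd.
by rewrite /ball/= distrC.
Qed.

Lemma is_derive_continuous f (df : R) x : is_derive x 1 f df -> {for x, continuous f}.
Proof.
by move=> H; apply: differentiable_continuous; apply/derivable1_diffP; exact: ex_derive.
Qed.

(** The form without quotient covers [y = x] and can be compared directly with estimates that are
    uniform in another variable. *)
Lemma is_derive_distP f (df : R) x : is_derive x 1 f df <->
  forall e : R, 0 < e -> exists2 d : R, 0 < d & forall y, `|y - x| < d ->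
    `|f y - f x - df * (y - x)| <= e * `|y - x|.
Proof.
split=> [H e e0|H].
  have cv : h^-1 *: (f (h *: 1 + x) - f x) @[h --> 0^'] --> df.
    have /cvg_ex[/= l] := @ex_derive _ _ _ _ _ _ _ H.
    by rewrite -(@derive_val _ _ _ _ _ _ _ H) => /[dup] /cvg_lim <-.
  move/cvgrPdist_le : cv => /(_ e e0).
  rewrite near_withinE => /nbhs_ballP[d d0 Hd].
  exists d => // y yx; have [->|yx0] := eqVneq y x.
    by rewrite !subrr mulr0 subrr !normr0 mulr0.
  have yx1 : y - x != 0 by rewrite subr_eq0.
  have := Hd (y - x); rewrite /ball/= sub0r normrN => /(_ yx yx1).
  rewrite -ler_pdivrMr ?normr_gt0//; apply: le_trans.
  rewrite -normfV -normrM distrC /GRing.scale/= mulr1 subrK.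
  rewrite le_eqVlt; apply/orP; left; apply/eqP; congr `|_|; field; exact: yx1.
have cv : h^-1 *: (f (h *: 1 + x) - f x) @[h --> 0^'] --> df.
  apply/cvgrPdist_le => e e0; have [d d0 Hd] := H e e0.
  rewrite near_withinE; apply/nbhs_ballP; exists d => //= h.
  rewrite /ball/= sub0r normrN => hd h0.
  have hE : h *: 1 + x - x = h by rewrite addrK /GRing.scale/= mulr1.
  have := Hd (h *: 1 + x); rewrite hE => /(_ hd).
  rewrite -ler_pdivrMr ?normr_gt0//; apply: le_trans.
  rewrite -normfV -normrM distrC /GRing.scale/=.
  by rewrite le_eqVlt; apply/orP; left; apply/eqP; congr `|_|; field.
apply: DeriveDef; first by apply/cvg_ex; exists df.
exact: cvg_lim.
Qed.

Lemma periodic1_shift f x (k : int) : periodic1 f -> f (x + k%:~R) = f x.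
Proof.
move=> pf; have pn y (n : nat) : f (y + n%:R) = f y.
  by elim: n => [|n IH]; rewrite ?addr0// -natr1 addrA pf.
case: k => n; first exact: pn.
by rewrite NegzE mulrNz -[in RHS](subrK n.+1%:R x) pn -pmulrn.
Qed.

Lemma periodic1_floor f x : periodic1 f -> f (x - (Num.floor x)%:~R) = f x.
Proof. by move=> pf; rewrite -mulrNz periodic1_shift. Qed.

End RealAnalysis.

(** * Mean value theorem, integrals over segments and primitives *)

Section Integration.
Context {R : realType}.
Implicit Types (f g F : R -> R) (a b c x y : R).
Local Notation mu := (@lebesgue_measure R).

Lemma derive_mvt F f a b : a < b -> (forall x, a <= x <= b -> is_derive x 1 F (f x)) ->
  exists2 c, a < c < b & F b - F a = f c * (b - a).
Proof.
move=> ab dF; have [||c] := @MVT R F f a b ab.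
- by move=> x; rewrite in_itv/= => xab; apply: dF; lra.
- apply/continuous_within_itvP => //; split.
  + by move=> x; rewrite in_itv/= => xab; apply: is_derive_continuous; apply: dF; lra.
  + apply: cvg_at_right_filter; apply: (@is_derive_continuous R _ (f a)).
    by apply: dF; lra.
  + apply: cvg_at_left_filter; apply: (@is_derive_continuous R _ (f b)).
    by apply: dF; lra.
by rewrite in_itv/= => cab e; exists c.
Qed.

Lemma derive_ge0_le F f a b : a <= b -> (forall x, a <= x <= b -> is_derive x 1 F (f x)) ->
  (forall x, a <= x <= b -> 0 <= f x) -> F a <= F b.
Proof.
rewrite le_eqVlt => /orP[/eqP->//|ab] dF f0.
have [c cab e] := derive_mvt ab dF.
by rewrite -subr_ge0 e mulr_ge0// ?f0//; lra.
Qed.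

Lemma continuous_itv_integrable f a b : continuous f ->
  mu.-integrable `[a, b] (EFin \o f).
Proof.
move=> cf; apply: continuous_compact_integrable; first exact: segment_compact.
by apply: continuous_subspaceT.
Qed.

Lemma Rintegral_itv_split f a b c : continuous f -> a <= c -> c <= b ->
  \int[mu]_(x in `[a, b]) f x =
  \int[mu]_(x in `[a, c]) f x + \int[mu]_(x in `[c, b]) f x.
Proof.
move=> cf ac cb; rewrite -(@Rintegral_itv_obnd_cbnd _ c).
  rewrite -(@Rintegral_itvB _ f (BLeft a) (BRight b)) ?bnd_simp//.
    by rewrite addrC subrK.
  exact: continuous_itv_integrable.
apply: (@integrableS _ _ _ mu `[c, b]) => //.
  by apply: subset_itvr; rewrite bnd_simp.
exact: continuous_itv_integrable.
Qed.

(** The witness is the oriented integral from 0 to [x], since the integral over the wrongly ordered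
    segment is 0. To the right of a point [a] below both 0 and [x], it differs by a constant from
    the integral starting at [a], to which the fundamental theorem applies. *)
Lemma primitive_exists f : continuous f ->
  exists F, forall x, is_derive x 1 F (f x).
Proof.
move=> cf.
exists (fun x => \int[mu]_(y in `[0, x]) f y - \int[mu]_(y in `[x, 0]) f y) => x.
have empty y z : y < z -> \int[mu]_(w in `[z, y]) f w = 0.
  by move=> yz; rewrite set_itv_ge ?Rintegral_set0// bnd_simp -ltNge.
have [a ax a0] : exists2 a, a < x & a < 0.
  exists (Num.min 0 x - 1); rewrite ?ltrBlDr.
    by rewrite gt_min; apply/orP; right; lra.
  by rewrite gt_min; apply/orP; left; lra.
have E y : a < y -> \int[mu]_(w in `[0, y]) f w - \int[mu]_(w in `[y, 0]) f w =
    \int[mu]_(w in `[a, y]) f w - \int[mu]_(w in `[a, 0]) f w.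
  move=> ay; have [y0|y0|->] := ltgtP y 0; last by rewrite !subrr.
  - by rewrite (empty y 0)// (@Rintegral_itv_split f a 0 y)// ?ltW//; ring.
  - by rewrite (empty 0 y)// (@Rintegral_itv_split f a y 0)// ?ltW//; ring.
have xx : x < x + 1 by rewrite ltrDl.
have [dG Gf] := continuous_FTC1_closed xx (continuous_itv_integrable _ _ cf) ax (cf x).
apply/is_derive_distP => e e0.
have /is_derive_distP/(_ e e0)[d d0 Hd] : is_derive x 1
    (fun y => \int[mu]_(w in `[a, y]) f w) (f x).
  by rewrite -Gf derive1E; apply: DeriveDef.
exists (Num.min d (x - a)); first by rewrite lt_min d0 subr_gt0.
move=> y; rewrite lt_min => /andP[yd]; rewrite ltr_norml => /andP[ya _].
have {ya}ay : a < y by clear -ya; lra.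
rewrite (E y ay) (E x ax).
by have := Hd y yd; congr (`| _ | <= _); ring.
Qed.

Lemma Rintegral_FTC f F a b : a <= b -> continuous f ->
  (forall x, is_derive x 1 F (f x)) ->
  \int[mu]_(x in `[a, b]) f x = F b - F a.
Proof.
rewrite le_eqVlt => /orP[/eqP<-|ab] cf dF.
  by rewrite set_itv1 Rintegral_set1 subrr.
have cF : continuous F by move=> x; apply: is_derive_continuous.
rewrite /Rintegral (@continuous_FTC2 _ f F)//.
- exact: continuous_subspaceT.
- split.
  + by move=> x _; exact: (@ex_derive _ _ _ _ _ _ _ (dF x)).
  + apply: cvg_at_right_filter; exact: cF.
  + apply: cvg_at_left_filter; exact: cF.
- by move=> x _; rewrite derive1E; exact: (@derive_val _ _ _ _ _ _ _ (dF x)).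
Qed.

End Integration.

(* The library states these rules for sums and products of functions; the
   forms below apply to explicit abstractions. *)
Section Calculus.
Context {R : realType}.
Implicit Types (f g F : R -> R) (a b c x y df dg : R).

Lemma continuous_const a : continuous (fun _ : R => a).
Proof. by move=> x; apply: cvg_cst. Qed.

Lemma continuous_var : continuous (fun x : R => x).
Proof. by move=> x; apply: cvg_id. Qed.

Lemma continuous_add f g : continuous f -> continuous g -> continuous (fun x => f x + g x).
Proof. by move=> cf cg x; apply: continuousD; [exact: cf|exact: cg]. Qed.

Lemma continuous_opp f : continuous f -> continuous (fun x => - f x).
Proof. by move=> cf x; apply: continuousN; exact: cf. Qed.

Lemma continuous_sub f g : continuous f -> continuous g -> continuous (fun x => f x - g x).
Proof. by move=> cf cg; apply: continuous_add => //; exact: continuous_opp. Qed.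

Lemma continuous_mul f g : continuous f -> continuous g -> continuous (fun x => f x * g x).
Proof. by move=> cf cg x; apply: continuousM; [exact: cf|exact: cg]. Qed.

Lemma continuous_pow f n : continuous f -> continuous (fun x => f x ^+ n).
Proof.
move=> cf; elim: n => [|n IH]; first by under eq_fun do rewrite expr0; exact: continuous_const.
by under eq_fun do rewrite exprS; exact: continuous_mul.
Qed.

Lemma continuous_compose f g : continuous f -> continuous g -> continuous (fun x => f (g x)).
Proof. by move=> cf cg x; apply: continuous_comp; [exact: cg|exact: cf]. Qed.

Lemma continuous_abs f : continuous f -> continuous (fun x => `|f x|).
Proof. by move=> cf; apply: continuous_compose => //; exact: norm_continuous. Qed.

Lemma continuous_bigsum n (f : 'I_n -> R -> R) : (forall i, continuous (f i)) ->
  continuous (fun x => \sum_(i < n) f i x).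
Proof.
elim: n f => [|n IH] f cf.
  by under eq_fun do rewrite big_ord0; exact: continuous_const.
under eq_fun do rewrite big_ord_recr.
by apply: continuous_add => //; exact: IH.
Qed.

Lemma is_derive_const a x : is_derive x 1 (fun _ : R => a) 0.
Proof. exact: is_derive_cst. Qed.

Lemma is_derive_var x : is_derive x 1 (fun x : R => x) 1.
Proof. exact: is_derive_id. Qed.

Lemma is_derive_add f g df dg x : is_derive x 1 f df -> is_derive x 1 g dg ->
  is_derive x 1 (fun x => f x + g x) (df + dg).
Proof. by move=> *; exact: is_deriveD. Qed.

Lemma is_derive_opp f df x : is_derive x 1 f df -> is_derive x 1 (fun x => - f x) (- df).
Proof. by move=> *; exact: is_deriveN. Qed.

Lemma is_derive_sub f g df dg x : is_derive x 1 f df -> is_derive x 1 g dg ->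
  is_derive x 1 (fun x => f x - g x) (df - dg).
Proof. by move=> *; exact: is_deriveB. Qed.

Lemma is_derive_mul f g df dg x : is_derive x 1 f df -> is_derive x 1 g dg ->
  is_derive x 1 (fun x => f x * g x) (df * g x + f x * dg).
Proof.
move=> hf hg; have -> : df * g x + f x * dg = f x *: dg + g x *: df.
  by rewrite /GRing.scale/= addrC (mulrC df).
exact: is_deriveM.
Qed.

Lemma is_derive_scale c f df x : is_derive x 1 f df ->
  is_derive x 1 (fun x => c * f x) (c * df).
Proof.
by move=> hf; have := is_derive_mul (is_derive_const c x) hf; rewrite mul0r add0r.
Qed.

Lemma is_derive_compose f g df dg x : is_derive x 1 g dg -> is_derive (g x) 1 f df ->
  is_derive x 1 (fun x => f (g x)) (df * dg).
Proof.
by move=> hg hf; have := is_derive1_comp hf hg; rewrite /GRing.scale.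
Qed.

End Calculus.

(** * Linearity and order for integrals over segments *)

Section IntegrationAlgebra.
Context {R : realType}.
Implicit Types (f g F : R -> R) (a b c x y : R).
Local Notation mu := (@lebesgue_measure R).

Lemma Rintegral_itv_add f g a b : continuous f -> continuous g ->
  \int[mu]_(x in `[a, b]) (f x + g x) =
  \int[mu]_(x in `[a, b]) f x + \int[mu]_(x in `[a, b]) g x.
Proof. by move=> cf cg; rewrite RintegralD//; exact: continuous_itv_integrable. Qed.

Lemma Rintegral_itv_sub f g a b : continuous f -> continuous g ->
  \int[mu]_(x in `[a, b]) (f x - g x) =
  \int[mu]_(x in `[a, b]) f x - \int[mu]_(x in `[a, b]) g x.
Proof. by move=> cf cg; rewrite RintegralB//; exact: continuous_itv_integrable. Qed.

Lemma Rintegral_itv_scale f c a b : continuous f ->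
  \int[mu]_(x in `[a, b]) (c * f x) = c * \int[mu]_(x in `[a, b]) f x.
Proof. by move=> cf; rewrite RintegralZl//; exact: continuous_itv_integrable. Qed.

Lemma Rintegral_itv_le f g a b : continuous f -> continuous g ->
  (forall x, a <= x <= b -> f x <= g x) ->
  \int[mu]_(x in `[a, b]) f x <= \int[mu]_(x in `[a, b]) g x.
Proof.
move=> cf cg fg; apply: le_Rintegral => //; exact: continuous_itv_integrable.
Qed.

Lemma Rintegral_itv_norm f a b : continuous f ->
  `|\int[mu]_(x in `[a, b]) f x| <= \int[mu]_(x in `[a, b]) `|f x|.
Proof.
by move=> cf; apply: le_normr_Rintegral => //; exact: continuous_itv_integrable.
Qed.

Lemma Rintegral01_const c : \int[mu]_(x in `[0, 1]) c = c.
Proof.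
have dF x : is_derive x 1 (fun x => c * x) c.
  by have := is_derive_scale c (is_derive_var x); rewrite mulr1.
by rewrite (Rintegral_FTC (@ler01 R) (@continuous_const R c) dF); ring.
Qed.

Lemma Rintegral_itv_sum n (f : 'I_n -> R -> R) a b : (forall i, continuous (f i)) ->
  \int[mu]_(x in `[a, b]) (\sum_(i < n) f i x) =
  \sum_(i < n) \int[mu]_(x in `[a, b]) f i x.
Proof.
elim: n f => [|n IH] f cf.
  by rewrite big_ord0; under eq_Rintegral do rewrite big_ord0; rewrite Rintegral_cst// mul0r.
rewrite big_ord_recr/= -IH// -Rintegral_itv_add//; last exact: continuous_bigsum.
by apply: eq_Rintegral => x _; rewrite big_ord_recr.
Qed.

End IntegrationAlgebra.

(** * Fejer kernel and Sobolev embedding *)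

Section Trigonometry.
Context {R : realType}.
Implicit Types (x y z : R).

Lemma sin_shift x (k : int) : sin (x + 2 * pi * k%:~R) = sin x.
Proof.
have H y (n : nat) : sin (y + 2 * pi * n%:R) = sin y.
  rewrite [RHS](_ : _ = sin (y + pi *+ 2 *+ n)); last first.
    by rewrite (periodicn (@sinD2pi R)).
  by congr sin; rewrite -mulr_natr -(mulr_natr pi); ring.
case: k => n; first exact: H.
rewrite NegzE mulrNz -(H (x + _) n.+1); congr sin.
by rewrite -pmulrn; ring.
Qed.

Lemma cos_shift x (k : int) : cos (x + 2 * pi * k%:~R) = cos x.
Proof. by rewrite -!sinDpihalf addrAC sin_shift. Qed.

End Trigonometry.

Section Fejer.
Context {R : realType}.
Implicit Types (f : R -> R) (x y z e : R) (N : nat) (k : int).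
Local Notation mu := (@lebesgue_measure R).

(** The Fejer kernel of period 1, that is [1 / N] times the squared modulus of the sum of
    [exp(2 i pi j z)] over [j < N]. *)
Definition fejer N z : R := N%:R^-1 *
  ((\sum_(j < N) cos (2 * pi * j%:R * z)) ^+ 2 +
   (\sum_(j < N) sin (2 * pi * j%:R * z)) ^+ 2).

Lemma fejer_ge0 N z : 0 <= fejer N z.
Proof. by rewrite mulr_ge0 ?invr_ge0// addr_ge0// sqr_ge0. Qed.

Lemma fejer_double N z : fejer N z =
  N%:R^-1 * \sum_(j < N) \sum_(l < N) cos (2 * pi * (j%:Z - l%:Z)%:~R * z).
Proof.
rewrite /fejer !expr2 !big_distrlr -big_split; congr (_ * _).
apply: eq_bigr => j _; rewrite -big_split; apply: eq_bigr => l _.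
by rewrite /= -cosB; congr cos; rewrite intrD mulrNz; ring.
Qed.

(** Both sums telescope, because [2 sin z cos(2 j z) = sin((2 j + 1) z) - sin((2 j - 1) z)] and
    similarly for the sines. Keeping the factor [2 * sin z] avoids a case distinction at its
    zeros. *)
Lemma dirichlet_sum N z :
  2 * sin z * (\sum_(j < N) cos (2 * j%:R * z)) = sin (2 * N%:R * z - z) + sin z /\
  2 * sin z * (\sum_(j < N) sin (2 * j%:R * z)) = cos z - cos (2 * N%:R * z - z).
Proof.
elim: N => [|N [IHc IHs]].
  by rewrite !big_ord0 !mulr0 mul0r sub0r sinN cosN; split; ring.
rewrite !big_ord_recr/= !mulrDr IHc IHs.
have -> : 2 * N.+1%:R * z - z = 2 * N%:R * z + z by rewrite -natr1; ring.
by rewrite !sinD !cosD sinN cosN; split; ring.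
Qed.

(** Decay of the kernel away from the integers, which makes it concentrate at 0 as [N] grows. *)
Lemma fejer_sin_le N z : sin (pi * z) ^+ 2 * fejer N z <= N%:R^-1.
Proof.
have [hc hs] := dirichlet_sum N (pi * z).
have E j : 2 * pi * j * z = 2 * j * (pi * z) by ring.
rewrite /fejer (eq_bigr (fun j : 'I_N => cos (2 * j%:R * (pi * z)))); last first.
  by move=> j _; rewrite E.
rewrite [X in _ + X ^+ 2](eq_bigr (fun j : 'I_N => sin (2 * j%:R * (pi * z)))); last first.
  by move=> j _; rewrite E.
rewrite mulrCA -[leRHS]mulr1 ler_wpM2l ?invr_ge0//.
move: hc hs; set c := \sum_(j < N) _; set s := \sum_(j < N) _.
set A := 2 * N%:R * (pi * z) - pi * z; set B := pi * z => hc hs.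
have hA := cos2Dsin2 A; have hB := cos2Dsin2 B.
(* After [hc] and [hs] this is the squared length of a sum of two unit vectors, [(sin A, - cos A)]
   and [(sin B, cos B)]; the parallelogram identity bounds it by 4. *)
have : (2 * sin B * c) ^+ 2 + (2 * sin B * s) ^+ 2 <= 4.
  rewrite hc hs; move: hA hB.
  move: (cos A) (sin A) (cos B) (sin B) => p q r t h1 h2.
  have := sqr_ge0 (q - t); have := sqr_ge0 (r + p).
  by nra.
by clear; move: (sin B) => t h; nra.
Qed.

Lemma continuous_trig (k : R) x :
  continuous (fun y => cos (2 * pi * k * (x - y))) /\
  continuous (fun y => sin (2 * pi * k * (x - y))).
Proof.
have ca : continuous (fun y => 2 * pi * k * (x - y)).
  by apply: continuous_mul; [exact: continuous_const|apply: continuous_sub; [exact: continuous_const|exact: continuous_var]].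
by split; apply: continuous_compose => //; [exact: continuous_cos|exact: continuous_sin].
Qed.

Lemma continuous_fejer N x : continuous (fun y => fejer N (x - y)).
Proof.
apply: continuous_mul; first exact: continuous_const.
by apply: continuous_add; apply: continuous_pow; apply: continuous_bigsum => i;
  [exact: (continuous_trig _ _).1|exact: (continuous_trig _ _).2].
Qed.

Lemma Rintegral01_cos k x :
  \int[mu]_(y in `[0, 1]) cos (2 * pi * k%:~R * (x - y)) = (k == 0)%:R.
Proof.
have [->|k0] := eqVneq k 0.
  by under eq_Rintegral do rewrite mulr0 mul0r cos0; rewrite Rintegral01_const.
set w := 2 * pi * k%:~R.
have w0 : w != 0 by rewrite !mulf_neq0 ?intr_eq0// gt_eqF// pi_gt0.
have dF y : is_derive y 1 (fun y => - w^-1 * sin (w * (x - y))) (cos (w * (x - y))).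
  have h1 : is_derive y 1 (fun y => w * (x - y)) (w * (0 - 1)).
    by apply: is_derive_scale; apply: is_derive_sub.
  have h2 := is_derive_compose h1 (is_derive_sin (w * (x - y))).
  have := is_derive_scale (- w^-1) h2; congr (is_derive _ _ _ _); field.
  exact: w0.
have [cc _] := continuous_trig k%:~R x.
rewrite (Rintegral_FTC (@ler01 R) cc dF) subr0.
have -> : w * x = w * (x - 1) + 2 * pi * k%:~R by rewrite /w; ring.
by rewrite sin_shift subrr.
Qed.

(** In the double sum only the [N] diagonal terms have a nonzero integral. *)
Lemma Rintegral01_fejer N x : (0 < N)%N ->
  \int[mu]_(y in `[0, 1]) fejer N (x - y) = 1.
Proof.
move=> N0; under eq_Rintegral do rewrite fejer_double.
rewrite Rintegral_itv_scale; last first.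
  by do 2![apply: continuous_bigsum => ?]; exact: (continuous_trig _ _).1.
rewrite Rintegral_itv_sum; last by move=> j; apply: continuous_bigsum => l; exact: (continuous_trig _ _).1.
rewrite (eq_bigr (fun=> 1)); first by rewrite sumr_const card_ord mulVf// pnatr_eq0 -lt0n.
move=> j _; rewrite Rintegral_itv_sum; last by move=> l; exact: (continuous_trig _ _).1.
rewrite (bigD1 j)//= Rintegral01_cos subrr eqxx big1 ?addr0// => l lj.
rewrite Rintegral01_cos subr_eq0 eqz_nat; case: eqP => // /esym/val_inj lj'.
by rewrite lj' eqxx in lj.
Qed.

(** Near [x] continuity gives the term [e]. Elsewhere the sine is bounded below by a positive
    minimum, so a large [C] absorbs twice the maximum of [|f|]. The factor [sin ^+ 2] is the one
    that [fejer_sin_le] cancels. *)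
Lemma sin_sq_modulus f x e : continuous f -> 0 < x < 1 -> 0 < e ->
  exists2 C : R, 0 <= C & forall y, 0 <= y <= 1 ->
    `|f x - f y| <= e + C * sin (pi * (x - y)) ^+ 2.
Proof.
move=> cf /andP[x0 x1] e0.
have [d d0 Hd] := continuous_dist (cf x) e0.
(* The bounds [x] and [1 - x] give [|x - y| <= 1 - r] for [y] in [[0, 1]], away from the second zero
   of [sin (pi * t)] at [t = 1]; the bound [1 / 2] makes [[r, 1 - r]] nonempty. *)
pose r := Num.min (Num.min d (1 / 2)) (Num.min x (1 - x)).
have r0 : 0 < r by rewrite !lt_min d0 x0 subr_gt0 x1; lra.
have rd : r <= d by rewrite !ge_min lexx.
have r2 : r <= 1 / 2 by rewrite !ge_min lexx orbT.
have rx : r <= x by rewrite !ge_min lexx !orbT.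
have rx1 : r <= 1 - x by rewrite !ge_min lexx !orbT.
have cs : continuous (fun t : R => sin (pi * t)).
  apply: continuous_compose; first exact: continuous_sin.
  by apply: continuous_mul; [exact: continuous_const|exact: continuous_var].
have rr : r <= 1 - r by lra.
have [c] := EVT_min rr (continuous_subspaceT cs).
rewrite in_itv/= => /andP[c1 c2] Hc.
have sc : 0 < sin (pi * c).
  apply: sin_gt0_pi; have := pi_gt0 R => p0.
  by rewrite pmulr_rgt0// gtr_pMr//; lra.
have [M _ HM] := EVT_max (@ler01 R) (continuous_subspaceT (continuous_abs cf)).
exists (2 * `|f M| / sin (pi * c) ^+ 2).
  by rewrite divr_ge0 ?sqr_ge0// mulr_ge0.
move=> y y01; have [xy|xy] := ltP `|x - y| r.
  apply: ler_wpDr.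
    by rewrite mulr_ge0 ?sqr_ge0// divr_ge0 ?sqr_ge0// mulr_ge0.
  by rewrite distrC ltW// Hd// distrC (lt_le_trans xy).
have sE : sin (pi * (x - y)) ^+ 2 = sin (pi * `|x - y|) ^+ 2.
  by have [h|h] := ger0P (x - y); rewrite // mulrN sinN sqrrN.
have hs : sin (pi * c) <= sin (pi * `|x - y|).
  apply: Hc; rewrite in_itv/= xy ler_norml.
  by clear -y01 rx rx1; lra.
have hM z : 0 <= z <= 1 -> `|f z| <= `|f M| by move=> z01; apply: HM; rewrite in_itv.
apply: (@le_trans _ _ (2 * `|f M|)).
  rewrite (le_trans (ler_normB _ _))// mulrDl mul1r lerD ?hM// (ltW x0) ltW//.
apply: ler_wpDl; first exact: ltW.
rewrite sE mulrAC ler_pdivlMr ?exprn_gt0// ler_wpM2l ?mulr_ge0//.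
by rewrite ler_sqr ?nnegrE// ltW// (lt_le_trans sc).
Qed.

(** The kernel is nonnegative of mass 1, so [f x] minus its Fejer mean is the integral of
    [(f x - f y) * fejer N (x - y)]. By [sin_sq_modulus] this is at most [e / 2 + C / N]. *)
Lemma fejer_bound f x S : continuous f -> 0 < x < 1 ->
  (forall N, (0 < N)%N -> `|\int[mu]_(y in `[0, 1]) (f y * fejer N (x - y))| <= S) ->
  `|f x| <= S.
Proof.
move=> cf x01 HS; apply/ler_addgt0Pr => e e0.
have e2 : 0 < e / 2 by rewrite divr_gt0.
have [C C0 HC] := sin_sq_modulus cf x01 e2.
have [N N0 HN] : exists2 N, (0 < N)%N & C * N%:R^-1 <= e / 2.
  exists (Num.trunc (C / (e / 2))).+1 => //.
  rewrite ler_pdivrMr ?ltr0n// mulrC -ler_pdivrMr//.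
  by rewrite ltW// truncnS_gt// divr_ge0// ltW.
have cK := @continuous_fejer N x.
have key : `|\int[mu]_(y in `[0, 1]) ((f x - f y) * fejer N (x - y))| <= e.
  have cfy : continuous (fun y => f x - f y) by apply: continuous_sub => //; exact: continuous_const.
  apply: (le_trans (Rintegral_itv_norm _ _ _)); first exact: continuous_mul.
  apply: (@le_trans _ _ (\int[mu]_(y in `[0, 1]) (e / 2 * fejer N (x - y) + C * N%:R^-1))).
    apply: Rintegral_itv_le.
    - by apply: continuous_abs; apply: continuous_mul.
    - by apply: continuous_add; [apply: continuous_mul => //|]; exact: continuous_const.
    - move=> y y01; rewrite normrM (ger0_norm (fejer_ge0 _ _)).
      apply: le_trans (ler_wpM2r (fejer_ge0 N (x - y)) (HC y y01)) _.
      by rewrite mulrDl lerD2l -mulrA ler_wpM2l// fejer_sin_le.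
  rewrite Rintegral_itv_add; [|by apply: continuous_mul => //; exact: continuous_const|exact: continuous_const].
  by rewrite (Rintegral_itv_scale _ _ _ cK) Rintegral01_fejer// Rintegral01_const; lra.
have : f x = \int[mu]_(y in `[0, 1]) ((f x - f y) * fejer N (x - y)) +
             \int[mu]_(y in `[0, 1]) (f y * fejer N (x - y)).
  have cfy : continuous (fun y => f x - f y) by apply: continuous_sub => //; exact: continuous_const.
  rewrite -Rintegral_itv_add; [|exact: continuous_mul..].
  under eq_Rintegral do rewrite -mulrDl subrK.
  by rewrite (Rintegral_itv_scale _ _ _ cK) Rintegral01_fejer// mulr1.
by move=> ->; rewrite (le_trans (ler_normD _ _))// addrC lerD// HS.
Qed.

(** Expanding the cosine of the difference gives the scalar product of [(cos (w * x), sin (w * x))],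
    a unit vector, with the pair of Fourier integrals; the rest is Cauchy-Schwarz, through
    Lagrange's identity. *)
Lemma fourier_coef_sq_le f k x : continuous f ->
  (\int[mu]_(y in `[0, 1]) (f y * cos (2 * pi * k%:~R * (x - y)))) ^+ 2
    <= fourier_sqmod f k.
Proof.
move=> cf; set w := 2 * pi * k%:~R.
have cc : continuous (fun y => cos (w * y)).
  apply: continuous_compose; first exact: continuous_cos.
  by apply: continuous_mul; [exact: continuous_const|exact: continuous_var].
have cs : continuous (fun y => sin (w * y)).
  apply: continuous_compose; first exact: continuous_sin.
  by apply: continuous_mul; [exact: continuous_const|exact: continuous_var].
rewrite (_ : \int[mu]_(y in _) _ =
    cos (w * x) * (\int[mu]_(y in `[0, 1]) (f y * cos (w * y))) +
    sin (w * x) * (\int[mu]_(y in `[0, 1]) (f y * sin (w * y)))); last first.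
  have cfc := continuous_mul cf cc; have cfs := continuous_mul cf cs.
  rewrite -!Rintegral_itv_scale// -Rintegral_itv_add; [|by apply: continuous_mul => //; exact: continuous_const..].
  by apply: eq_Rintegral => y _; rewrite mulrBr cosB; ring.
rewrite /fourier_sqmod -/w.
move: (\int[mu]_(y in _) _) (\int[mu]_(y in _) _) => b a.
have := cos2Dsin2 (w * x); move: (cos (w * x)) (sin (w * x)) => c s h.
have -> : a ^+ 2 + b ^+ 2 = (c * a + s * b) ^+ 2 + (c * b - s * a) ^+ 2.
  by rewrite -[LHS]mul1r -h; ring.
by rewrite lerDl sqr_ge0.
Qed.

(** The Fejer mean is the average over [l] of Fourier sums over the windows of frequencies [j - l],
    [j < N]. Grouping by [l] avoids the triangular weights: a common bound on the windows
    suffices. *)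
Lemma fejer_mean_le f x B N : continuous f -> (0 < N)%N ->
  (forall l, (l < N)%N -> \sum_(j < N)
    `|\int[mu]_(y in `[0, 1]) (f y * cos (2 * pi * (j%:Z - l%:Z)%:~R * (x - y)))| <= B) ->
  `|\int[mu]_(y in `[0, 1]) (f y * fejer N (x - y))| <= B.
Proof.
move=> cf N0 HB.
have c1 j l : continuous (fun y => f y * cos (2 * pi * (j%:Z - l%:Z)%:~R * (x - y))).
  by apply: continuous_mul => //; exact: (continuous_trig _ _).1.
have E : \int[mu]_(y in `[0, 1]) (f y * fejer N (x - y)) = N%:R^-1 *
    \sum_(l < N) \sum_(j < N)
    \int[mu]_(y in `[0, 1]) (f y * cos (2 * pi * (j%:Z - l%:Z)%:~R * (x - y))).
  under eq_bigr do rewrite -Rintegral_itv_sum//.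
  rewrite -Rintegral_itv_sum; last by move=> l; apply: continuous_bigsum.
  rewrite -Rintegral_itv_scale; last by do 2![apply: continuous_bigsum => ?].
  apply: eq_Rintegral => y _; rewrite fejer_double mulrCA; congr (_ * _).
  rewrite [RHS]exchange_big mulr_sumr; apply: eq_bigr => j _ /=.
  by rewrite mulr_sumr.
rewrite E normrM ger0_norm ?invr_ge0// ler_pdivrMl ?ltr0n//.
apply: (le_trans (ler_norm_sum _ _ _)).
apply: (@le_trans _ _ (\sum_(l < N) B)); last first.
  by rewrite sumr_const card_ord mulr_natl lexx.
by apply: ler_sum => l _; apply: (le_trans (ler_norm_sum _ _ _)); exact: HB.
Qed.

End Fejer.

(** * Uniform smallness from smallness in H^s, s > 1/2 *)

Section SobolevEmbedding.
Context {R : realType}.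
Implicit Types (f : R -> R) (x y z e s a : R) (N : nat) (k : int).
Local Notation mu := (@lebesgue_measure R).

Lemma pseries_bounded a : 1 < a ->
  exists C : R, forall N, \sum_(n < N) (n.+1%:R `^ a)^-1 <= C.
Proof.
move=> a1; have a10 : 0 < a - 1 by rewrite subr_gt0.
exists (1 + (a - 1)^-1) => N.
(* Comparison with the integral of [x ^ (- a)] from 1 to [N + 1], in a form that induction proves:
   each step is the mean value theorem for the power [1 - a]. *)
suff H : \sum_(n < N.+1) (n.+1%:R `^ a)^-1 <=
    1 + (1 - N.+1%:R `^ (1 - a)) / (a - 1).
  apply: (@le_trans _ _ (\sum_(n < N.+1) (n.+1%:R `^ a)^-1)).
    by rewrite big_ord_recr/= lerDl invr_ge0 powR_ge0.
  by apply: (le_trans H); rewrite lerD2l -[leRHS]mul1r ler_wpM2r ?invr_ge0 ?(ltW a10)//.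
elim: N => [|N IH].
  by rewrite big_ord_recr big_ord0/= !powR1 subrr mul0r invr1 add0r addr0 lexx.
rewrite big_ord_recr/=; apply: (le_trans (lerD IH (lexx _))).
rewrite -addrA lerD2l -lerBrDl -mulrBl ler_pdivlMr//.
have lt12 : N.+1%:R < N.+2%:R :> R by rewrite ltr_nat.
have [c /andP[c1 c2] E] := @derive_mvt R (fun x => x `^ (1 - a))
  (fun x => (1 - a) * x `^ (1 - a - 1)) _ _ lt12
  (fun x hx => is_derive1_powR _ (lt_le_trans (ltr0Sn R N) (proj1 (andP hx)))).
have -> : 1 - N.+2%:R `^ (1 - a) - (1 - N.+1%:R `^ (1 - a)) =
    - (N.+2%:R `^ (1 - a) - N.+1%:R `^ (1 - a)) by ring.
rewrite E -(natrB _ (leqnSn N.+1)) subSnn mulr1 -mulNr opprB [leRHS]mulrC.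
rewrite ler_wpM2r ?(ltW a10)//.
have -> : 1 - a - 1 = - a by ring.
have c0 : 0 < c by rewrite (lt_trans _ c1).
rewrite powRN lef_pV2 ?posrE ?powR_gt0//.
by apply: ge0_ler_powR; rewrite ?nnegrE//; lra.
Qed.

(** The weight at frequency [k] is at least [(|k| + 1) ^ (2 s)]. Splitting the window at [j = l]
    gives two sums over distances to [l], each below the series with exponent [2 * s > 1], whatever
    [l] is. *)
Lemma weight_sum_bounded s : 1 / 2 < s ->
  exists2 V : R, 0 < V & forall N l, (l < N)%N ->
    \sum_(j < N) ((1 + (2 * pi * (j%:Z - l%:Z)%:~R) ^+ 2) `^ s)^-1 <= V.
Proof.
move=> s2; have [|C HC] := @pseries_bounded (2 * s); first lra.
pose r (n : nat) : R := (n.+1%:R `^ (2 * s))^-1.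
have r0 n : 0 <= r n by rewrite invr_ge0 powR_ge0.
have HC' n : \sum_(0 <= i < n) r i <= C by rewrite big_mkord.
have C0 : 0 <= C by have := HC 0%N; rewrite big_ord0.
(* The added 1 makes the bound positive even though [C] is only known to be nonnegative. *)
exists (C + C + 1) => [|N l lN]; first lra.
have term (j : nat) : ((1 + (2 * pi * (j%:Z - l%:Z)%:~R) ^+ 2) `^ s)^-1 <=
    r `|j%:Z - l%:Z|%N.
  set k := j%:Z - l%:Z.
  have -> : (2 * pi * k%:~R) ^+ 2 = (2 * pi * `|k|%N%:R) ^+ 2 :> R.
    rewrite ![(_ * _) ^+ 2]exprMn; congr (_ * _).
    by rewrite natr_absz intr_norm real_normK ?num_real.
  move: `|k|%N => n; rewrite /r powRrM lef_pV2 ?posrE ?powR_gt0//; last first.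
    by rewrite ltr_pwDl// sqr_ge0.
  apply: ge0_ler_powR; rewrite ?nnegrE ?powR_ge0//; first lra.
    by rewrite addr_ge0// sqr_ge0.
  rewrite powR_mulrn// -natr1; have p2 := pi_ge2 R.
  have n0 : (0 : R) <= n%:R by [].
  (* Integrality enters here: [(n + 1) ^ 2 <= 1 + 16 n ^ 2] follows from [n <= n ^ 2]. *)
  have n1 : n%:R <= n%:R ^+ 2 :> R by rewrite -natrX ler_nat; case: (n) => // m; rewrite -mulnn leq_pmulr.
  have : (2 * 2 * n%:R) ^+ 2 <= (2 * pi * n%:R) ^+ 2 :> R.
    by rewrite ler_sqr ?nnegrE ?mulr_ge0 ?pi_ge0// ler_wpM2r// ler_wpM2l.
  by move: ((2 * pi * n%:R) ^+ 2) => q; move: (n%:R) n0 n1 => t; clear; nra.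
apply: (@le_trans _ _ (\sum_(j < N) r `|j%:Z - l%:Z|%N)).
  by apply: ler_sum => j _; exact: term.
rewrite -(big_mkord xpredT (fun j => r `|j%:Z - l%:Z|%N)).
rewrite (@big_cat_nat _ _ _ l)//= ?(ltnW lN)//.
apply: (@le_trans _ _ (C + C)); last by rewrite lerDl.
apply: lerD.
(* Reversed, the terms [j < l] have distances 1 to [l]; adding the term of distance 0 gives a
   partial sum of length [l + 1]. *)
- rewrite big_nat_rev/= add0n (le_trans _ (HC' l.+1))// [leRHS]big_nat_recl//=.
  apply: ler_wpDl => //; rewrite !big_nat; apply: ler_sum => i /= il.
  by rewrite distnEr ?leq_subr// subKn.
- rewrite -[X in \sum_(X <= _ < _) _]add0n big_addn (le_trans _ (HC' (N - l)%N))//.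
  by apply: ler_sum => i _; rewrite distnEl ?leq_addl// addnK.
Qed.

Lemma sum_le_esum (F : int -> R) (r : seq int) : uniq r -> (forall k, 0 <= F k) ->
  ((\sum_(k <- r) F k)%:E <= \esum_(k in [set: int]) (F k)%:E)%E.
Proof.
move=> ur F0; apply: esum_ge; exists [set` r].
  by split => //; exact: finite_seq.
by rewrite -fsbig_seq// sumEFin.
Qed.

Lemma fourier_sqmod_ge0 f k : 0 <= fourier_sqmod f k.
Proof. by rewrite addr_ge0// sqr_ge0. Qed.

(** Fejer means are controlled by window sums of Fourier coefficients. Weighted Cauchy-Schwarz, in
    the form of the inequality [amgm], bounds such a sum by the sum of inverse weights and the
    Sobolev norm. *)
Lemma sobolev_embedding_sup s : 1 / 2 < s -> forall e, 0 < e ->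
  exists2 d : R, 0 < d & forall f, continuous f -> periodic1 f ->
    (sobolev_sqnorm s f < d%:E)%E -> forall x, `|f x| <= e.
Proof.
move=> s2 e e0; have [V V0 HV] := weight_sum_bounded s2.
exists (e ^+ 2 / V); first by rewrite divr_gt0// exprn_gt0.
move=> f cf pf fd.
have H01 x : 0 < x < 1 -> `|f x| <= e.
  move=> x01; apply: fejer_bound => // N N0; apply: fejer_mean_le => // l lN.
  pose w k : R := (1 + (2 * pi * k%:~R) ^+ 2) `^ s.
  have w0 k : 0 < w k by rewrite powR_gt0// ltr_pwDl// sqr_ge0.
  pose d k := \int[mu]_(y in `[0, 1]) (f y * cos (2 * pi * k%:~R * (x - y))).
  (* The two coefficients are balanced so that, with weight sum [V] and squared norm [e ^+ 2 / V],
     each half contributes [e / 2]. *)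
  have amgm k : `|d k| <= e / V / 2 * (w k)^-1 + V / e / 2 * (w k * fourier_sqmod f k).
    have hd : `|d k| ^+ 2 <= fourier_sqmod f k.
      by rewrite real_normK ?num_real//; exact: fourier_coef_sq_le.
    apply: (@le_trans _ _ (e / V / 2 * (w k)^-1 + V / e / 2 * (w k * `|d k| ^+ 2))); last first.
      by rewrite lerD2l ler_wpM2l ?divr_ge0 ?(ltW e0) ?(ltW V0)// ler_wpM2l// ltW.
    rewrite -subr_ge0.
    have -> : e / V / 2 * (w k)^-1 + V / e / 2 * (w k * `|d k| ^+ 2) - `|d k| =
      V / e / 2 * (w k)^-1 * (w k * `|d k| - e / V) ^+ 2.
      by field; rewrite !gt_eqF.
    by rewrite mulr_ge0 ?sqr_ge0// mulr_ge0 ?invr_ge0 ?(ltW (w0 k))// !divr_ge0// ltW.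
  have hq : \sum_(j < N) (w (j%:Z - l%:Z) * fourier_sqmod f (j%:Z - l%:Z)) <= e ^+ 2 / V.
    rewrite -lee_fin; apply: le_trans (ltW fd).
    rewrite -(big_mkord xpredT (fun j => w (j%:Z - l%:Z) * fourier_sqmod f (j%:Z - l%:Z))).
    rewrite -(big_map (fun j : nat => j%:Z - l%:Z) xpredT
      (fun k => w k * fourier_sqmod f k)).
    apply: sum_le_esum.
      rewrite map_inj_uniq ?iota_uniq// => i j /addIr.
      by case.
    by move=> k; rewrite mulr_ge0 ?fourier_sqmod_ge0// ltW.
  apply: (@le_trans _ _ (\sum_(j < N) (e / V / 2 * (w (j%:Z - l%:Z))^-1 +
      V / e / 2 * (w (j%:Z - l%:Z) * fourier_sqmod f (j%:Z - l%:Z))))).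
    by apply: ler_sum => j _; exact: amgm.
  rewrite big_split/= -!mulr_sumr.
  apply: (@le_trans _ _ (e / V / 2 * V + V / e / 2 * (e ^+ 2 / V))).
    apply: lerD; apply: ler_wpM2l => //; rewrite ?divr_ge0 ?(ltW e0) ?(ltW V0)//.
    exact: HV.
  have -> : e / V / 2 * V + V / e / 2 * (e ^+ 2 / V) = e by field; rewrite !gt_eqF.
  exact: lexx.
(* [fejer_bound] covers interior points only; the endpoint follows by continuity and the other
   points by periodicity. *)
have H0 : `|f 0| <= e.
  apply/ler_addgt0Pr => h h0.
  have [d d0 Hd] := continuous_dist (cf 0) h0.
  pose y := Num.min (d / 2) (1 / 2).
  have y01 : 0 < y < 1 by rewrite lt_min gt_min; lra.
  have yd : y < d by rewrite gt_min; apply/orP; left; lra.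
  have := Hd y; rewrite subr0 ger0_norm ?(ltW (proj1 (andP y01)))// => /(_ yd).
  have := H01 y y01.
  move=> h1 h2; rewrite -[X in `|X|](subrK (f y)) (le_trans (ler_normD _ _))//.
  by rewrite addrC lerD// distrC ltW.
move=> x; rewrite -(periodic1_floor x pf).
have := ge_floor x; have := lt_succ_floor x; rewrite intrD => h1 h2.
set z := x - _; have : 0 <= z < 1 by rewrite /z subr_ge0 ltrBlDl h1 h2.
case/andP; rewrite le_eqVlt => /orP[/eqP<-//|z0 z1].
by apply: H01; rewrite z0 z1.
Qed.

End SobolevEmbedding.

(** * Sobolev norms under differentiation and a.e. equality *)

Section SobolevNorm.
Context {R : realType}.
Implicit Types (f g : R -> R) (x y z e s a : R) (k : int).
Local Notation mu := (@lebesgue_measure R).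

Lemma C1fun_is_derive f x : C1fun f -> is_derive x 1 f (derive1 f x).
Proof. by case=> df _; rewrite derive1E; apply: DeriveDef => //; exact: df. Qed.

Lemma C1fun_continuous f : C1fun f -> continuous f.
Proof. by move=> cf x; exact: is_derive_continuous (C1fun_is_derive x cf). Qed.

Lemma C1funB f g : C1fun f -> C1fun g ->
  C1fun (fun x => f x - g x) /\
  derive1 (fun x => f x - g x) = (fun x => derive1 f x - derive1 g x).
Proof.
move=> cf cg.
have dfg x := is_derive_sub (C1fun_is_derive x cf) (C1fun_is_derive x cg).
have E : derive1 (fun x => f x - g x) = (fun x => derive1 f x - derive1 g x).
  by apply/funext => x; rewrite derive1E; exact: (@derive_val _ _ _ _ _ _ _ (dfg x)).
split=> //; split; first by move=> x; exact: (@ex_derive _ _ _ _ _ _ _ (dfg x)).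
by rewrite E; apply: continuous_sub; [exact: cf.2|exact: cg.2].
Qed.

Lemma periodic_derive1 f : periodic1 f -> C1fun f -> periodic1 (derive1 f).
Proof.
move=> pf cf x.
have h : is_derive x 1 (fun y => f (y + 1)) (derive1 f (x + 1) * (1 + 0)).
  exact: is_derive_compose (is_derive_add (is_derive_var x) (is_derive_const 1 x)) (C1fun_is_derive _ cf).
rewrite addr0 mulr1 (_ : (fun y => _) = f) in h; last first.
  by apply/funext => y; rewrite pf.
by rewrite [RHS]derive1E (@derive_val _ _ _ _ _ _ _ h).
Qed.

(** This allows the time derivative, known only up to null sets, to be replaced by a continuous
    representative. *)
Lemma fourier_sqmod_ae f g k : measurable_fun setT f -> measurable_fun setT g ->
  {ae mu, forall x, f x = g x} -> fourier_sqmod f k = fourier_sqmod g k.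
Proof.
move=> mf mg fg.
have H (h : R -> R) : continuous h ->
    \int[mu]_(x in `[0, 1]) (f x * h x) = \int[mu]_(x in `[0, 1]) (g x * h x).
  move=> ch; rewrite /Rintegral; congr fine.
  have mh := continuous_measurable_fun ch.
  apply: ae_eq_integral => //.
  - by apply/measurable_EFinP; apply: measurable_funTS; apply: measurable_funM.
  - by apply/measurable_EFinP; apply: measurable_funTS; apply: measurable_funM.
  - case: fg => N [mN N0 sN]; exists N; split => // x nx.
    by apply: sN => /= fx; apply: nx => _; rewrite /= fx.
have ck : continuous (fun x : R => 2 * pi * k%:~R * x).
  by apply: continuous_mul; [exact: continuous_const|exact: continuous_var].
rewrite /fourier_sqmod !H//.
- by apply: continuous_compose => //; exact: continuous_sin.
- by apply: continuous_compose => //; exact: continuous_cos.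
Qed.

Lemma sobolev_sqnorm_ae s f g : measurable_fun setT f -> measurable_fun setT g ->
  {ae mu, forall x, f x = g x} -> sobolev_sqnorm s f = sobolev_sqnorm s g.
Proof.
by move=> mf mg fg; apply: eq_esum => k _; rewrite (fourier_sqmod_ae k mf mg fg).
Qed.

(** Integration by parts: periodicity cancels the boundary terms, and the cosine and sine integrals
    are exchanged up to sign with a factor [w]. *)
Lemma fourier_sqmod_derive f k : C1fun f -> periodic1 f ->
  fourier_sqmod (derive1 f) k = (2 * pi * k%:~R) ^+ 2 * fourier_sqmod f k.
Proof.
move=> cf pf; have f01 : f 1 = f 0 by rewrite -[1 in LHS]add0r pf.
have cf0 := C1fun_continuous cf; have cf1 := cf.2.
rewrite /fourier_sqmod; set w := 2 * pi * k%:~R.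
have ck : continuous (fun x : R => w * x).
  by apply: continuous_mul; [exact: continuous_const|exact: continuous_var].
have cc : continuous (fun y => cos (w * y)).
  by apply: continuous_compose => //; exact: continuous_cos.
have cs : continuous (fun y => sin (w * y)).
  by apply: continuous_compose => //; exact: continuous_sin.
have dw x : is_derive x 1 (fun x : R => w * x) w.
  by have := is_derive_scale w (is_derive_var x); rewrite mulr1.
have dc x : is_derive x 1 (fun x => f x * cos (w * x))
    (derive1 f x * cos (w * x) - w * (f x * sin (w * x))).
  have := is_derive_mul (C1fun_is_derive x cf)
    (is_derive_compose (dw x) (is_derive_cos (w * x))).
  by congr (is_derive _ _ _ _); ring.
have ds x : is_derive x 1 (fun x => f x * sin (w * x))
    (derive1 f x * sin (w * x) + w * (f x * cos (w * x))).
  have := is_derive_mul (C1fun_is_derive x cf)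
    (is_derive_compose (dw x) (is_derive_sin (w * x))).
  by congr (is_derive _ _ _ _); ring.
have w1 : w * 1 = 0 + w by rewrite mulr1 add0r.
have cfc := continuous_mul cf0 cc; have cfs := continuous_mul cf0 cs.
have cwc : continuous (fun x => w * (f x * cos (w * x))) by apply: continuous_mul => //; exact: continuous_const.
have cws : continuous (fun x => w * (f x * sin (w * x))) by apply: continuous_mul => //; exact: continuous_const.
have := Rintegral_FTC (@ler01 R) (continuous_sub (continuous_mul cf1 cc) cws) dc.
rewrite w1 cos_shift mulr0 f01 subrr Rintegral_itv_sub//; last exact: continuous_mul.
rewrite (Rintegral_itv_scale _ _ _ cfs) => /eqP; rewrite subr_eq0 => /eqP ->.
have := Rintegral_FTC (@ler01 R) (continuous_add (continuous_mul cf1 cs) cwc) ds.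
rewrite w1 sin_shift mulr0 f01 subrr Rintegral_itv_add//; last exact: continuous_mul.
rewrite (Rintegral_itv_scale _ _ _ cfc) => /eqP; rewrite addr_eq0 => /eqP ->.
by ring.
Qed.

(** Termwise, [q (1 + q) ^ (s - 1) <= (1 + q) ^ s] with [q] the squared frequency. *)
Lemma sobolev_sqnorm_derive s f : C1fun f -> periodic1 f ->
  (sobolev_sqnorm (s - 1) (derive1 f) <= sobolev_sqnorm s f)%E.
Proof.
move=> cf pf; apply: le_esum => k _; rewrite lee_fin fourier_sqmod_derive// mulrA.
rewrite ler_wpM2r ?fourier_sqmod_ge0//.
set q := (2 * pi * k%:~R) ^+ 2; have q0 : 0 <= q by exact: sqr_ge0.
rewrite -[in leRHS](subrK 1 s) (@powRD _ _ (s - 1) 1); last by apply/implyP => _; rewrite gt_eqF// ltr_pwDl.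
by rewrite powRr1 ?addr_ge0// ler_wpM2l ?powR_ge0// lerDr.
Qed.

Lemma cvg0_near_lt (T : Type) (F : set_system T) {FF : Filter F} (h : T -> \bar R) (d : R) :
  0 < d -> h x @[x --> F] --> 0%E -> \forall x \near F, (h x < d%:E)%E.
Proof.
move=> d0 /(_ [set y | (y < d%:E)%E]); apply.
by apply: open_nbhs_nbhs; split; [exact: open_ereal_lt_ereal|rewrite /= lte_fin].
Qed.

End SobolevNorm.

(** * From Sobolev continuity in time to estimates uniform in space *)

Section Solution.
Context {R : realType}.
Implicit Types (s t r x e : R) (u : R -> R -> R).

(** The embedding applies to [u r - u t] with exponent [s], and to its derivative with exponent
    [s - 1], which still exceeds [1 / 2]. *)
Lemma C0_sobolev_uniform_C1 s u : 3 / 2 < s -> C0_sobolev s u -> (forall t, 0 <= t -> C1fun (u t)) ->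
  forall t e, 0 <= t -> 0 < e -> exists2 d : R, 0 < d &
    forall r, 0 <= r -> `|r - t| < d -> forall x,
    `|u r x - u t x| <= e /\ `|derive1 (u r) x - derive1 (u t) x| <= e.
Proof.
move=> hs [su cu] u1 t e t0 e0.
have hs1 : 1 / 2 < s by move: hs; clear; lra.
have hs2 : 1 / 2 < s - 1 by move: hs; clear; lra.
have [d1 d10 H1] := sobolev_embedding_sup hs1 e0.
have [d2 d20 H2] := sobolev_embedding_sup hs2 e0.
have m0 : 0 < Num.min d1 d2 by rewrite lt_min d10 d20.
have : \forall r \near within `[0, +oo[ (nbhs t),
    (sobolev_sqnorm s (u r \- u t)%R < (Num.min d1 d2)%:E)%E.
  by apply: cvg0_near_lt; [exact: m0|exact: cu].
rewrite near_withinE => /nbhs_ballP[d d0 Hd].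
exists d => // r r0 rt x.
have {Hd}h := Hd r; have {h}h : (sobolev_sqnorm s (u r \- u t)%R < (Num.min d1 d2)%:E)%E.
  by apply: h; rewrite ?/ball/= ?in_itv/= ?r0// distrC.
have [C1 dE] := C1funB (u1 r r0) (u1 t t0).
have pr : periodic1 (u r) by have [[]] := su r r0.
have pt : periodic1 (u t) by have [[]] := su t t0.
have pd : periodic1 (fun x => u r x - u t x) by move=> y; rewrite pr pt.
split.
  apply: (H1 (fun x => u r x - u t x)) => //; first exact: C1fun_continuous.
  by apply: lt_le_trans h _; rewrite lee_fin ge_min lexx.
rewrite -[X in `|X|]/((fun x => derive1 (u r) x - derive1 (u t) x) x) -dE.
apply: H2; [exact: C1.2|exact: periodic_derive1|].
apply: le_lt_trans (sobolev_sqnorm_derive s C1 pd) _.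
by apply: lt_le_trans h _; rewrite lee_fin ge_min lexx orbT.
Qed.

(** Once [ut t] is replaced by the continuous [g], the error of the difference quotient is
    continuous and periodic, so its small norm in H^(s-1) makes it uniformly small. *)
Lemma sobolev_time_derivative_uniform s u (ut : R -> R -> R) : 3 / 2 < s ->
  C0_sobolev s u -> (forall t, 0 <= t -> C1fun (u t)) ->
  C0_sobolev (s - 1) ut -> sobolev_time_derivative (s - 1) u ut ->
  forall t (g : R -> R), 0 <= t -> continuous g -> periodic1 g ->
  {ae (@lebesgue_measure R), forall x, ut t x = g x} ->
  forall e, 0 < e -> exists2 d : R, 0 < d &
    forall r, 0 <= r -> `|r - t| < d -> forall x,
    `|u r x - u t x - (r - t) * g x| <= e * `|r - t|.
Proof.
move=> hs [su cu] u1 [sut _] dut t g t0 cg pg aeg e e0.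
have hs2 : 1 / 2 < s - 1 by move: hs; clear; lra.
have [d1 d10 H1] := sobolev_embedding_sup hs2 e0.
have : \forall r \near within `[0, +oo[ t^', (sobolev_sqnorm (s - 1)
    (fun x => (u r x - u t x) / (r - t) - ut t x)%R < d1%:E)%E.
  by apply: cvg0_near_lt; [exact: d10|exact: dut].
rewrite near_withinE near_withinE => /nbhs_ballP[d d0 Hd].
exists d => // r r0 rt x.
have [->|nrt] := eqVneq r t; first by rewrite !subrr mul0r subr0 normr0 mulr0.
have rt0 : r - t != 0 by rewrite subr_eq0.
have cr := C1fun_continuous (u1 r r0); have ct := C1fun_continuous (u1 t t0).
have pr : periodic1 (u r) by have [[]] := su r r0.
have pt : periodic1 (u t) by have [[]] := su t t0.
have cq : continuous (fun x => (u r x - u t x) / (r - t)).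
  by apply: continuous_mul; [exact: continuous_sub|exact: continuous_const].
have h : (sobolev_sqnorm (s - 1) (fun x => (u r x - u t x) / (r - t) - ut t x)%R < d1%:E)%E.
  by apply: Hd; rewrite ?/ball/= ?in_itv/= ?r0// distrC.
have mt : measurable_fun setT (ut t) by have [[]] := sut t t0.
rewrite (@sobolev_sqnorm_ae _ _ _ (fun x => (u r x - u t x) / (r - t) - g x)) in h.
- have := H1 _ (continuous_sub cq cg) _ h x; rewrite -ler_pdivrMr ?normr_gt0// -normfV -normrM.
  have -> : (u r x - u t x - (r - t) * g x) / (r - t) = (u r x - u t x) / (r - t) - g x.
    by field.
  by apply => y; rewrite pr pt pg.
- by apply: measurable_funB => //; exact: continuous_measurable_fun.
- by apply: continuous_measurable_fun; exact: continuous_sub.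
- case: aeg => N [mN N0 sN]; exists N; split => // y ny.
  by apply: sN => /= fy; apply: ny; rewrite /= fy.
Qed.

End Solution.

(** * Convolution with the derivative of the kernel *)

Section Kernel.
Context {R : realType}.
Implicit Types (f G P K : R -> R) (x y z : R).
Local Notation mu := (@lebesgue_measure R).

(** This is [e <= 3], equivalent to [2 <= coth(1/2)]. It comes from [exp(-1/6) >= 5/6] and
    [(6/5) ^ 6 < 3]. *)
Lemma expR_le3 x y : x <= y + 1 -> expR x <= 3 * expR y.
Proof.
move=> xy; apply: (@le_trans _ _ (expR (y + 1))); first by rewrite ler_expR.
rewrite expRD mulrC ler_wpM2r ?expR_ge0//.
have h : 5 / 6 <= expR (- (1 / 6)) :> R.
  by apply: le_trans (expR_ge1Dx _); lra.
have h1 : expR (1 / 6) <= 6 / 5 :> R.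
  rewrite -[expR _]invrK -expRN -[6 / 5]invrK lef_pV2 ?posrE ?expR_gt0 ?invr_gt0 ?divr_gt0//.
  by apply: le_trans h; rewrite invf_div.
have -> : (1 : R) = 6%:R * (1 / 6) by field.
rewrite expRM_natl; apply: (@le_trans _ _ ((6 / 5) ^+ 6)); last by lra.
by rewrite lerXn2r ?nnegrE ?expR_ge0//; lra.
Qed.

Lemma sinh_half_gt0 : 0 < sinh (1 / 2 : R).
Proof. by rewrite /sinh divr_gt0// subr_gt0 ltr_expR; lra. Qed.

Lemma derive1_kernel_p (m : int) z : m%:~R < z < m%:~R + 1 ->
  derive1 (@kernel_p R) z = (4 * sinh (1 / 2))^-1 *
    (expR (z - m%:~R - 1 / 2) - expR (1 / 2 - (z - m%:~R))).
Proof.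
move=> /andP[mz zm]; have s0 := sinh_half_gt0.
have dl : is_derive z 1 (fun y => y - m%:~R - 1 / 2) (1 - 0 - 0).
  exact: is_derive_sub (is_derive_sub (is_derive_var z) (is_derive_const _ z)) (is_derive_const _ z).
have dr : is_derive z 1 (fun y => - (y - m%:~R - 1 / 2)) (- (1 - 0 - 0)).
  exact: is_derive_opp.
have d1 := is_derive_compose dl (is_derive_expR _).
have d2 := is_derive_compose dr (is_derive_expR _).
have := is_derive_scale (4 * sinh (1 / 2))^-1 (is_derive_add d1 d2).
set F := (fun x => _); set dF := (X in is_derive _ _ _ X) => hF.
have : is_derive z 1 (@kernel_p R) dF.
  apply: near_eq_is_derive hF.
  have : \forall y \near z, m%:~R < y /\ y < m%:~R + 1.
    by near=> y; split; near: y; [exact: lt_nbhsr|exact: lt_nbhsl].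
  apply: filterS => y [my ym].
  rewrite /kernel_p (_ : Num.floor y = m); last first.
    by apply/floor_def; rewrite (ltW my) intrD.
  by rewrite /F /cosh; field; rewrite gt_eqF.
move=> [_]; rewrite -derive1E => ->; rewrite /dF.
have -> : - (z - m%:~R - 1 / 2) = 1 / 2 - (z - m%:~R) by ring.
by ring.
Unshelve. all: by end_near. Qed.

(** The values of [h] at [a], [b] and [c] are free, as needed for the derivative of the kernel at
    its jump. Measurability of [h] is obtained by gluing two open intervals and three points. *)
Lemma Rintegral_piecewise (h h1 h2 : R -> R) (a b c : R) : a <= c -> c <= b ->
  continuous h1 -> continuous h2 ->
  (forall y, a < y < c -> h y = h1 y) -> (forall y, c < y < b -> h y = h2 y) ->
  \int[mu]_(y in `[a, b]) h y =
  \int[mu]_(y in `[a, c]) h1 y + \int[mu]_(y in `[c, b]) h2 y.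
Proof.
move=> ac cb ch1 ch2 hh1 hh2.
have mI (i : interval R) : measurable [set` i] by exact: measurable_itv.
have intr (f : R -> R) (i : interval R) : continuous f ->
    mu.-integrable `[a, b] (EFin \o (f \_ [set` i])).
  move=> cf; rewrite -restrict_EFin; apply/integrable_restrict => //.
  apply: (@integrableS _ _ _ mu `[a, b]) => //; first exact: measurableI.
  exact: continuous_itv_integrable.
have mh : measurable_fun `[a, b] h.
  apply: (@measurable_funS _ _ _ _
    (`]a, c[ `|` `]c, b[ `|` ([set a] `|` [set b] `|` [set c]))).
  - by repeat apply: measurableU.
  - move=> y; rewrite /= !in_itv/= => /andP[ay yb].
    have [->|ya] := eqVneq y a; first by right; left; left.
    have [->|yb'] := eqVneq y b; first by right; left; right.
    have [yc|cy|->] := ltgtP y c; last by right; right.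
      by left; left; rewrite /= lt_neqAle eq_sym ya ay.
    by left; right; rewrite /= lt_neqAle yb' yb.
  apply/measurable_funU; [by apply: measurableU|by repeat apply: measurableU|].
  split; apply/measurable_funU => //; try by apply: measurableU.
    split.
      apply: (@eq_measurable_fun _ _ _ _ _ h1).
        by move=> y; rewrite inE/= in_itv/= => /hh1.
      by apply: measurable_funTS; exact: continuous_measurable_fun.
    apply: (@eq_measurable_fun _ _ _ _ _ h2).
      by move=> y; rewrite inE/= in_itv/= => /hh2.
    by apply: measurable_funTS; exact: continuous_measurable_fun.
  split; last exact: measurable_fun_set1.
  by apply/measurable_funU => //; split; exact: measurable_fun_set1.
(* The second piece is open at [c], so that the pieces are disjoint. *)
transitivity (\int[mu]_(y in `[a, b]) ((h1 \_ `[a, c]) y + (h2 \_ `]c, b]) y)).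
  rewrite /Rintegral; congr fine; apply: ae_eq_integral => //.
  - exact/measurable_EFinP.
  - have := intr h1 `[a, c] ch1; have := intr h2 `]c, b] ch2.
    move=> /measurable_int/measurable_EFinP m2 /measurable_int/measurable_EFinP m1.
    by apply/measurable_EFinP; exact: measurable_funD.
  - have n1 (z : R) : mu.-negligible [set z].
      by apply/negligibleP => //; exact: lebesgue_measure_set1.
    apply: negligibleS (negligibleU (negligibleU (n1 a) (n1 b)) (n1 c)) => y /= ny.
    apply: contrapT => nabc; apply: ny; rewrite in_itv/= => /andP[ay yb].
    have ya : y != a by apply/eqP => ya; apply: nabc; left; left.
    have yb' : y != b by apply/eqP => yb'; apply: nabc; left; right.
    have [yc|cy|yc] := ltgtP y c; last by case: nabc; right.
      rewrite hh1 ?yc ?andbT; last by rewrite lt_neqAle eq_sym ya ay.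
      by rewrite !patchE !mem_setE !in_itv/= ay (ltW yc) ltNge (ltW yc)/= addr0.
    rewrite hh2 ?cy ?lt_neqAle ?yb' ?yb//.
    by rewrite !patchE !mem_setE !in_itv/= cy yb ay leNgt cy/= add0r.
rewrite RintegralD//; [|exact: intr..]; rewrite -!Rintegral_mkcondr.
congr (_ + _); last first.
  rewrite -(@Rintegral_itv_obnd_cbnd _ c).
    congr (Rintegral _ _ _); apply/seteqP; split => y; rewrite /= !in_itv/=.
      by case.
    by move=> /andP[cy yb]; rewrite cy yb (le_trans ac (ltW cy)).
  apply: (@integrableS _ _ _ mu `[c, b]) => //.
    by apply: subset_itvr; rewrite bnd_simp.
  exact: continuous_itv_integrable.
congr (Rintegral _ _ _); apply/seteqP; split => y; rewrite /= !in_itv/=.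
  by case.
by move=> /andP[ay yc]; rewrite ay yc (le_trans yc cb).
Qed.

(** By periodicity of [G], the difference [F (y + 1) - expR w * F y] has derivative 0. Such
    primitives express integrals over the moving period [[x - 1, x]] as functions differentiable in
    [x]. *)
Lemma exp_moments (G : R -> R) (w : R) : continuous G -> periodic1 G ->
  exists F : R -> R, (forall y, is_derive y 1 F (expR (w * y) * G y)) /\
    exists c : R, forall y, F (y + 1) = expR w * F y + c.
Proof.
move=> cG pG.
have cw : continuous (fun y => expR (w * y) * G y).
  apply: continuous_mul => //; apply: continuous_compose; first exact: continuous_expR.
  by apply: continuous_mul; [exact: continuous_const|exact: continuous_var].
have [F dF] := primitive_exists cw; exists F; split=> //.
exists (F 1 - expR w * F 0) => y.
pose D z := F (z + 1) - expR w * F z.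
have dD z : is_derive z 1 D 0.
  have d1 : is_derive z 1 (fun z => z + 1 : R) (1 + 0).
    exact: is_derive_add (is_derive_var z) (is_derive_const 1 z).
  have := is_derive_sub (is_derive_compose d1 (dF (z + 1))) (is_derive_scale (expR w) (dF z)).
  have -> : w * (z + 1) = w * z + w by ring.
  by rewrite pG expRD; congr (is_derive _ _ _ _); ring.
have : D y = D 0.
  have [y0|y0|->//] := ltgtP y 0.
    by have [c _] := derive_mvt y0 (fun x _ => dD x); rewrite mul0r => /eqP;
      rewrite subr_eq0 => /eqP.
  by have [c _] := derive_mvt y0 (fun x _ => dD x); rewrite mul0r => /eqP;
    rewrite subr_eq0 => /eqP.
by rewrite /D add0r => /eqP; rewrite subr_eq => /eqP ->; ring.
Qed.

(* [P] and [K] play the roles of p * G and (p * G)'; the bound [2 |K| <= P]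
   expresses that the kernels p + 2 p' and p - 2 p' are nonnegative. *)
Definition pressure (C : R) G P K : Prop :=
  [/\ periodic1 P, periodic1 K,
      forall x, is_derive x 1 P (K x) & forall x, is_derive x 1 K (P x - G x)] /\
  [/\ forall x, 2 * `|K x| <= P x &
      forall B : R, (forall x, G x <= B) -> forall x, P x <= C * B].

Lemma convolution_derive_kernel : exists2 C : R, 0 <= C &
  forall G, continuous G -> periodic1 G -> (forall x, 0 <= G x) ->
  exists P K : R -> R, pressure C G P K /\
    forall x, circle_conv (derive1 (@kernel_p R)) G x = K x.
Proof.
have s0 := sinh_half_gt0.
set k0 := (4 * sinh (1 / 2 : R))^-1.
have k00 : 0 < k0 by rewrite invr_gt0 mulr_gt0.
(* If [G <= B], then [A] and [E] below are each at most [3 * B]. *)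
exists (6 * k0); first by rewrite mulr_ge0// ltW.
move=> G cG pG G0.
have [Fm [dFm [cm HFm]]] := exp_moments (-1) cG pG.
have [Fp [dFp [cp HFp]]] := exp_moments 1 cG pG.
(* [A] and [E] are the integrals over [[x - 1, x]] of [G y] against the exponentials of
   [x - y - 1/2] and of its opposite. Then p * G is [k0 * (A + E)] and its derivative is
   [k0 * (A - E)]. *)
pose A x := expR (x - 1 / 2) * (Fm x - Fm (x - 1)).
pose E x := expR (1 / 2 - x) * (Fp x - Fp (x - 1)).
have pA : periodic1 A.
  move=> x; rewrite /A addrK HFm.
  have -> : Fm x = expR (-1) * Fm (x - 1) + cm by rewrite -HFm subrK.
  have -> : x + 1 - 1 / 2 = x - 1 / 2 + 1 by ring.
  by rewrite [expR (x - 1 / 2 + 1)]expRD expRN; field; rewrite expR_eq0.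
have pE : periodic1 E.
  move=> x; rewrite /E addrK HFp.
  have -> : Fp x = expR (1) * Fp (x - 1) + cp by rewrite -HFp subrK.
  have -> : 1 / 2 - (x + 1) = 1 / 2 - x + - 1 by ring.
  by rewrite [expR (1 / 2 - x + - 1)]expRD expRN; field; rewrite expR_eq0.
have dsh x : is_derive x 1 (fun y => y - 1 : R) (1 - 0).
  exact: is_derive_sub (is_derive_var x) (is_derive_const 1 x).
have pGm x : G (x - 1) = G x by rewrite -[in RHS](subrK 1 x) pG.
have dA x : is_derive x 1 A (A x + (expR (- (1 / 2)) - expR (1 / 2)) * G x).
  have de : is_derive x 1 (fun y => y - 1 / 2 : R) (1 - 0).
    exact: is_derive_sub (is_derive_var x) (is_derive_const _ x).
  have := is_derive_mul (is_derive_compose de (is_derive_expR _))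
    (is_derive_sub (dFm x) (is_derive_compose (dsh x) (dFm (x - 1)))).
  congr (is_derive _ _ _ _); rewrite pGm /A.
  have -> : -1 * (x - 1) = - x + 1 by ring.
  have -> : -1 * x = - x by ring.
  rewrite !expRD [expR 1](_ : _ = expR (1 / 2) ^+ 2); last first.
    by rewrite -expRM_natl; congr expR; field.
  by rewrite !expRN; field; rewrite !expR_eq0.
have dE x : is_derive x 1 E (- E x + (expR (1 / 2) - expR (- (1 / 2))) * G x).
  have de : is_derive x 1 (fun y => 1 / 2 - y : R) (0 - 1).
    exact: is_derive_sub (is_derive_const _ x) (is_derive_var x).
  have := is_derive_mul (is_derive_compose de (is_derive_expR _))
    (is_derive_sub (dFp x) (is_derive_compose (dsh x) (dFp (x - 1)))).
  congr (is_derive _ _ _ _); rewrite pGm /E (mul1r x) (mul1r (x - 1)).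
  rewrite !expRD [expR (-1)](_ : _ = expR (- (1 / 2)) ^+ 2); last first.
    by rewrite -expRM_natl; congr expR; field.
  by rewrite !expRN; field; rewrite !expR_eq0.
have k0E : k0 * (2 * (expR (1 / 2) - expR (- (1 / 2)))) = 1.
  rewrite /k0 /sinh; field; rewrite subr_eq0 gt_eqF// ltr_expR; lra.
have x1x x : x - 1 < x by rewrite ltrBlDr ltrDl.
(* A combination of the two exponentials that is nonnegative on the period has a nonnegative
   integral against [G]. *)
have mono (x a b : R) :
    (forall y, x - 1 <= y <= x -> 0 <= a * expR y + b * expR (- y)) ->
    0 <= a * (Fp x - Fp (x - 1)) + b * (Fm x - Fm (x - 1)).
  move=> h.
  have := @derive_ge0_le R (fun y => a * Fp y + b * Fm y)
    (fun y => a * (expR (1 * y) * G y) + b * (expR (-1 * y) * G y)) _ _ (ltW (x1x x))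
    (fun y _ => is_derive_add (is_derive_scale a (dFp y)) (is_derive_scale b (dFm y))).
  rewrite -subr_ge0 => H; suff -> : a * (Fp x - Fp (x - 1)) + b * (Fm x - Fm (x - 1)) =
    a * Fp x + b * Fm x - (a * Fp (x - 1) + b * Fm (x - 1)).
    apply: H => y /h; rewrite mul1r mulN1r => hy.
    by rewrite !mulrA -mulrDl mulr_ge0.
  by ring.
(* On the period the two exponents differ by at most 1. Together with [EA] this is equivalent to
   [2 * |A - E| <= A + E]. *)
have AE x : A x <= 3 * E x.
  rewrite -subr_ge0 (_ : _ - _ = 3 * expR (1 / 2 - x) * (Fp x - Fp (x - 1)) +
    - expR (x - 1 / 2) * (Fm x - Fm (x - 1))); last by rewrite /A /E; ring.
  apply: mono => y yx; rewrite mulNr subr_ge0 -mulrA -!expRD.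
  by apply: expR_le3; lra.
have EA x : E x <= 3 * A x.
  rewrite -subr_ge0 (_ : _ - _ = - expR (1 / 2 - x) * (Fp x - Fp (x - 1)) +
    3 * expR (x - 1 / 2) * (Fm x - Fm (x - 1))); last by rewrite /A /E; ring.
  apply: mono => y yx; rewrite mulNr addrC subr_ge0 -mulrA -!expRD.
  by apply: expR_le3; lra.
exists (fun x => k0 * (A x + E x)), (fun x => k0 * (A x - E x)); split; [split; [split|split]|].
- by move=> x; rewrite pA pE.
- by move=> x; rewrite pA pE.
- move=> x; have := is_derive_scale k0 (is_derive_add (dA x) (dE x)).
  by congr (is_derive _ _ _ _); ring.
- move=> x; have := is_derive_scale k0 (is_derive_sub (dA x) (dE x)).
  congr (is_derive _ _ _ _).
  transitivity (k0 * (A x + E x) -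
    k0 * (2 * (expR (1 / 2) - expR (- (1 / 2)))) * G x); first by ring.
  by rewrite k0E mul1r.
- move=> x; rewrite normrM (gtr0_norm k00) mulrCA ler_pM2l//.
  by have := AE x; have := EA x; case: (ger0P (A x - E x)) => _; lra.
- move=> B GB x.
  have B0 : 0 <= B by apply: le_trans (GB 0).
  have AB : A x <= 3 * B.
    have [c /andP[c1 c2] e] := derive_mvt (x1x x) (fun y _ => dFm y).
    rewrite /A e (_ : x - (x - 1) = 1); last by ring.
    rewrite mulr1 mulrA -expRD.
    apply: (@le_trans _ _ (3 * G c)); last by rewrite ler_wpM2l.
    rewrite ler_wpM2r//; apply: (@le_trans _ _ (3 * expR 0)); last by rewrite expR0 mulr1.
    by apply: expR_le3; lra.
  have EB : E x <= 3 * B.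
    have [c /andP[c1 c2] e] := derive_mvt (x1x x) (fun y _ => dFp y).
    rewrite /E e (_ : x - (x - 1) = 1); last by ring.
    rewrite mulr1 mulrA -expRD.
    apply: (@le_trans _ _ (3 * G c)); last by rewrite ler_wpM2l.
    rewrite ler_wpM2r//; apply: (@le_trans _ _ (3 * expR 0)); last by rewrite expR0 mulr1.
    by apply: expR_le3; lra.
  rewrite (mulrC 6) -mulrA ler_pM2l//; lra.
- move=> x.
  have pK : periodic1 (fun x => k0 * (A x - E x)) by move=> y; rewrite pA pE.
  rewrite -(periodic1_floor x pK).
  (* For [y] in [[0, 1]] the point [x - y] crosses the integer [n] at [y = th]: the branch of the
     kernel is that of [h th] before and of [h (th + 1)] after. *)
  set n := Num.floor x; set th := x - n%:~R.
  have th0 : 0 <= th by rewrite subr_ge0 ge_floor.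
  have th1 : th < 1 by rewrite ltrBlDl -[1]/(1%:~R) -intrD lt_succ_floor.
  pose h (v : R) y := k0 * (expR (v - y - 1 / 2) - expR (1 / 2 - (v - y))) * G y.
  have ch v : continuous (h v).
    apply: continuous_mul => //; apply: continuous_mul; first exact: continuous_const.
    have cvy : continuous (fun y => v - y) by apply: continuous_sub; [exact: continuous_const|exact: continuous_var].
    by apply: continuous_sub; apply: continuous_compose; try exact: continuous_expR;
      apply: continuous_sub => //; exact: continuous_const.
  have dh v y : is_derive y 1 (fun y => k0 * (expR (v - 1 / 2) * Fm y - expR (1 / 2 - v) * Fp y))
      (h v y).
    have := is_derive_scale k0 (is_derive_sub (is_derive_scale (expR (v - 1 / 2)) (dFm y))
      (is_derive_scale (expR (1 / 2 - v)) (dFp y))).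
    congr (is_derive _ _ _ _); rewrite /h (mul1r y) (mulN1r y).
    have -> : v - y - 1 / 2 = v - 1 / 2 + - y by ring.
    have -> : 1 / 2 - (v - y) = 1 / 2 - v + y by ring.
    by rewrite [expR (v - 1 / 2 + - y)]expRD [expR (1 / 2 - v + y)]expRD; ring.
  rewrite /circle_conv (@Rintegral_piecewise _ (h th) (h (th + 1)) 0 1 th)//; last 3 first.
  + exact: ltW.
  + move=> y yth; rewrite (@derive1_kernel_p n); last by move: yth th0 th1; rewrite /th; clear; lra.
    by rewrite /h /th; congr (_ * (expR _ - expR _) * _); ring.
  + move=> y yth; rewrite (@derive1_kernel_p (n - 1)) intrD; last by move: yth th0 th1; rewrite /th; clear; lra.
    by rewrite /h /th; congr (_ * (expR _ - expR _) * _); ring.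
  rewrite (Rintegral_FTC th0 (ch _) (dh _)) (Rintegral_FTC (ltW th1) (ch _) (dh _)).
  (* The relations [HFm] and [HFp] move the part over [[th, 1]] back by one period, so that [[0, 1]]
     becomes [[th - 1, th]]. *)
  rewrite /A /E -[in Fm 1](add0r 1) -[in Fp 1](add0r 1) HFm HFp.
  have -> : Fm th = expR (-1) * Fm (th - 1) + cm by rewrite -HFm subrK.
  have -> : Fp th = expR 1 * Fp (th - 1) + cp by rewrite -HFp subrK.
  have -> : th + 1 - 1 / 2 = th - 1 / 2 + 1 by ring.
  have -> : 1 / 2 - (th + 1) = 1 / 2 - th + - 1 by ring.
  rewrite [expR (th - 1 / 2 + 1)]expRD [expR (1 / 2 - th + - 1)]expRD [expR (-1)]expRN.
  by field; rewrite expR_eq0.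
Qed.

End Kernel.

(** * Lower bound on the slope *)

Section Descent.
Context {R : realType}.
Implicit Types (u : R -> R -> R) (f G P K : R -> R) (x y z e t r v h M C a : R).

Lemma periodic_bounded f : continuous f -> periodic1 f ->
  exists n : R, forall x, `|f x| <= n.
Proof.
move=> cf pf.
have [c _ Hc] := EVT_max (@ler01 R) (continuous_subspaceT (continuous_abs cf)).
exists `|f c| => x; rewrite -(periodic1_floor x pf); apply: Hc.
rewrite in_itv/= subr_ge0 ge_floor/= lerBlDl.
by have := lt_succ_floor x; rewrite intrD => /ltW.
Qed.

Lemma periodic_uniformly_continuous f e : continuous f -> periodic1 f -> 0 < e ->
  exists2 d : R, 0 < d & forall x y, `|y - x| < d -> `|f y - f x| <= e.
Proof.
move=> cf pf e0; have e2 : 0 < e / 2 by rewrite divr_gt0.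
(* The modulus is written as a product, so that [Q] weakens as [n] grows and no sign of [n] is
   needed. *)
pose Q n x := forall y, `|y - x| * n < 1 -> `|f y - f x| <= e.
have [n Hn] : exists n, forall x, 0 <= x <= 1 -> Q n x.
  apply: locally_uniform_segment => x _.
  have [d d0 Hd] := continuous_dist (cf x) e2.
  exists (d / 2); first by rewrite divr_gt0.
  exists (2 / d) => m r nm _ rx y yr.
  have yr2 : `|y - r| < d / 2.
    rewrite -(invf_div 2 d) -[_^-1]mul1r ltr_pdivlMr ?divr_gt0//.
    by apply: le_lt_trans yr; rewrite ler_wpM2l.
  have yx : `|y - x| < d.
    rewrite -(subrK r y) -addrA (le_lt_trans (ler_normD _ _))// (splitr d) ltrD//.
  have rx2 : `|r - x| < d by apply: (lt_trans rx); lra.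
  rewrite -(subrK (f x) (f y)) -addrA (le_trans (ler_normD _ _))//.
  rewrite (splitr e) lerD ?(ltW (Hd _ _))// distrC.
  exact: ltW (Hd _ _).
exists (Num.max n 1)^-1; first by rewrite invr_gt0 lt_max ltr01 orbT.
move=> x y yx; rewrite -(periodic1_floor x pf).
set m := Num.floor x.
have -> : f y = f (y - m%:~R) by rewrite -mulrNz periodic1_shift.
apply: Hn.
  rewrite subr_ge0 ge_floor/= lerBlDl.
  by have := lt_succ_floor x; rewrite intrD => /ltW.
rewrite opprB addrA subrK.
apply: (@le_lt_trans _ _ (`|y - x| * Num.max n 1)).
  by rewrite ler_wpM2l// le_max lexx.
by rewrite -ltr_pdivlMr ?mul1r// lt_max ltr01 orbT.
Qed.

Lemma derive_gt0_right f (df : R) t : is_derive t 1 f df -> 0 <= f t -> 0 < df ->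
  exists2 d : R, 0 < d & forall r, t < r < t + d -> 0 <= f r.
Proof.
move=> /is_derive_distP dF f0 df0.
have [d d0 Hd] := dF _ df0; exists d => // r /andP[tr rd].
have := Hd r; rewrite ger0_norm ?subr_ge0 ?(ltW tr)// ltrBlDl => /(_ rd).
by rewrite ler_norml => /andP[+ _]; lra.
Qed.

(* The right-hand side is the rate at which the slope of u over [x, x + h] falls when
   both endpoints move with the velocity u(x) of the left one. *)
Lemma slope_rate_ge f P K C M h (eta : R) x (q : R) :
  C1fun f -> 0 <= C -> pressure C (fun y => 3 / 2 * f y ^+ 2) P K -> 0 < h ->
  (forall y, `|f y| <= M) -> (forall y, `|derive1 f y| <= M) ->
  (forall y z, `|z - y| <= h -> `|derive1 f z - derive1 f y| <= eta) ->
  q = (f (x + h) - f x) / h ->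
  q ^+ 2 - 3 / 2 * f x ^+ 2 + P x - M * eta - h * (M ^+ 2 * (C + 3)) <=
  q * derive1 f (x + h) + (K (x + h) - K x) / h.
Proof.
move=> cf C0 [[_ _ dP dK] [KP PB]] h0 fM dfM Heta qdef.
have M0 : 0 <= M by apply: le_trans (fM 0).
have xh : x < x + h by rewrite ltrDl.
have hE : x + h - x = h by ring.
have eta0 : 0 <= eta.
  by apply: le_trans (Heta 0 0 _); rewrite ?subrr ?normr0 ?(ltW h0).
have [c1 /andP[c11 c12]] := derive_mvt xh (fun y _ => C1fun_is_derive y cf).
rewrite hE => e1.
(* The quotient is a slope inside the interval, hence within [eta] of the slope at [x + h]. *)
have qE : q = derive1 f c1 by rewrite qdef e1; field; rewrite gt_eqF.
(* The quotient of [K] is [P - G] at [c2]. Moving [c2] to [x] costs [C * M ^+ 2] per unit length for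
   [P], and [3 / 2] times [2 * M ^+ 2] for [G]; hence the factor [C + 3]. *)
have [c2 /andP[c21 c22]] := derive_mvt xh (fun y _ => dK y).
rewrite hE => e2; rewrite e2 mulfK ?gt_eqF//.
have sqM y : f y ^+ 2 <= M ^+ 2.
  by rewrite -(real_normK (num_real (f y))) ler_sqr ?nnegrE.
have PM y : P y <= C * (3 / 2 * M ^+ 2).
  by apply: PB => z; rewrite ler_wpM2l.
have KM y : `|K y| <= C * M ^+ 2.
  have M2 : 0 <= C * M ^+ 2 by rewrite mulr_ge0// sqr_ge0.
  by have := KP y; have := PM y; lra.
have dPx : P x - h * (C * M ^+ 2) <= P c2.
  have [c3 /andP[c31 c32] e3] := derive_mvt c21 (fun y _ => dP y).
  have : `|P c2 - P x| <= C * M ^+ 2 * h.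
    rewrite e3 normrM [X in _ * X]ger0_norm ?subr_ge0 ?(ltW c21)//.
    by rewrite ler_pM ?subr_ge0 ?(ltW c21)//; lra.
  by rewrite ler_norml => /andP[+ _]; lra.
have dGx : f c2 ^+ 2 <= f x ^+ 2 + h * (2 * M ^+ 2).
  have [c3 /andP[c31 c32] e3] := derive_mvt c21
    (fun y _ => is_derive_mul (C1fun_is_derive y cf) (C1fun_is_derive y cf)).
  have : `|f c2 * f c2 - f x * f x| <= 2 * M ^+ 2 * h.
    rewrite e3 normrM [X in _ * X]ger0_norm ?subr_ge0 ?(ltW c21)//.
    rewrite ler_pM ?subr_ge0 ?(ltW c21)//; last lra.
    rewrite (le_trans (ler_normD _ _))// !normrM mulr_natl mulr2n expr2.
    by rewrite lerD// ler_pM.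
  by rewrite !expr2 ler_norml => /andP[_]; lra.
have qM : `|q| <= M by rewrite qE.
have dq : `|q * (derive1 f (x + h) - q)| <= M * eta.
  rewrite normrM ler_pM// qE; apply: Heta.
  by rewrite ger0_norm ?subr_ge0 ?(ltW c12)//; lra.
move: dq; rewrite ler_norml => /andP[dq _].
have -> : q * derive1 f (x + h) = q ^+ 2 + q * (derive1 f (x + h) - q) by ring.
by move: dq dPx dGx; clear; lra.
Qed.

(** The equation in pointwise form, [K] standing for the convolution term; uniformity in [x] allows
    evaluation at moving points. *)
Definition uniform_time_derivative u C t P K : Prop :=
  pressure C (fun x => 3 / 2 * u t x ^+ 2) P K /\
  forall e, 0 < e -> exists2 d : R, 0 < d & forall r, 0 <= r -> `|r - t| < d ->
    forall x, `|u r x - u t x - (r - t) * (- (u t x * derive1 (u t) x) - K x)|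
      <= e * `|r - t|.

(** A chain rule for which uniformity of the time derivative replaces joint differentiability.
    Straight lines can stand in for characteristics, because only the derivative at time [t]
    matters. *)
Lemma is_derive_along u C t P K x v : 0 < t -> C1fun (u t) ->
  uniform_time_derivative u C t P K ->
  is_derive t 1 (fun r => u r (x + (r - t) * v))
    ((v - u t x) * derive1 (u t) x - K x).
Proof.
move=> t0 cu [[[_ _ _ dK] _] ut]; apply/is_derive_distP => e e0.
have e3 : 0 < e / 3 by rewrite divr_gt0.
set g := fun x => - (u t x * derive1 (u t) x) - K x.
have cg : continuous g.
  apply: continuous_sub; last by move=> y; exact: is_derive_continuous (dK y).
  by apply: continuous_opp; apply: continuous_mul; [exact: C1fun_continuous|exact: cu.2].
have v0 : 0 < 1 + `|v| by rewrite ltr_pwDl.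
have [d1 d10 H1] := ut _ e3.
have [d2 d20 H2] := continuous_dist (cg x) e3.
have e4 : 0 < e / 3 / (1 + `|v|) by rewrite divr_gt0.
have /is_derive_distP/(_ _ e4)[d3 d30 H3] := C1fun_is_derive x cu.
have m0 : 0 < Num.min d2 d3 / (1 + `|v|) by rewrite divr_gt0// lt_min d20 d30.
exists (Num.min (Num.min t d1) (Num.min d2 d3 / (1 + `|v|))).
  by rewrite !lt_min t0 d10 m0.
move=> r; rewrite !lt_min => /andP[/andP[rt rd1]].
rewrite ltr_pdivlMr// lt_min => /andP[rd2 rd3].
rewrite subrr mul0r addr0; set y := x + (r - t) * v.
have yx : y - x = (r - t) * v by rewrite /y; ring.
have yxn : `|y - x| <= `|r - t| * (1 + `|v|).
  by rewrite yx normrM ler_wpM2l// lerDr.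
have r0 : 0 <= r by move: rt; rewrite ltr_norml => /andP[+ _]; lra.
have h1 := H1 r r0 rd1 y.
have h2 := ltW (H2 y (le_lt_trans yxn rd2)).
have h3 := H3 y (le_lt_trans yxn rd3).
have h3' : `|u t y - u t x - derive1 (u t) x * (y - x)| <= e / 3 * `|r - t|.
  apply: (le_trans h3); apply: (@le_trans _ _ (e / 3 / (1 + `|v|) * (`|r - t| * (1 + `|v|)))).
    by rewrite ler_wpM2l// ltW.
  by rewrite le_eqVlt; apply/orP; left; apply/eqP; field; rewrite gt_eqF.
have h2' : `|(r - t) * (g y - g x)| <= e / 3 * `|r - t|.
  by rewrite normrM mulrC ler_wpM2r.
(* Three errors of size [e / 3]: time increment at [y], space increment at time [t], and variation
   of [g] between [x] and [y]. *)
rewrite (_ : _ - _ - _ = (u r y - u t y - (r - t) * g y) +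
   (u t y - u t x - derive1 (u t) x * (y - x)) + (r - t) * (g y - g x)); last first.
  by rewrite yx /g; ring.
rewrite (le_trans (ler_normD _ _))// (_ : e * _ = e / 3 * `|r - t| + e / 3 * `|r - t| +
  e / 3 * `|r - t|); last by field.
by rewrite lerD// (le_trans (ler_normD _ _))// lerD.
Qed.

Definition C1_flow u : Prop :=
  [/\ forall t, 0 <= t -> C1fun (u t), forall t, 0 <= t -> periodic1 (u t) &
      forall t e, 0 <= t -> 0 < e -> exists2 d : R, 0 < d &
        forall r, 0 <= r -> `|r - t| < d -> forall x,
        `|u r x - u t x| <= e /\ `|derive1 (u r) x - derive1 (u t) x| <= e].

Lemma locally_bounded_C1 u a b : C1_flow u -> 0 <= a -> exists M : R, forall t, a <= t <= b ->
  forall x, `|u t x| <= M /\ `|derive1 (u t) x| <= M.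
Proof.
move=> [C1u peru contu] a0.
apply: locally_uniform_segment => t /andP[at_ _].
have t0 := le_trans a0 at_.
have [n1 H1] := periodic_bounded (C1fun_continuous (C1u _ t0)) (peru _ t0).
have [n2 H2] := periodic_bounded (C1u _ t0).2 (periodic_derive1 (peru _ t0) (C1u _ t0)).
have [d d0 Hd] := contu _ _ t0 (@ltr01 R).
exists d => //; exists (Num.max n1 n2 + 1) => m r nm /andP[ar _] rt x.
have [h1 h2] := Hd r (le_trans a0 ar) rt x.
have k1 : n1 <= Num.max n1 n2 by rewrite le_max lexx.
have k2 : n2 <= Num.max n1 n2 by rewrite le_max lexx orbT.
split.
  rewrite -(subrK (u t x) (u r x)) (le_trans (ler_normD _ _))// (le_trans _ nm)//.
  by rewrite addrC lerD// (le_trans (H1 x)).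
rewrite -(subrK (derive1 (u t) x) (derive1 (u r) x)) (le_trans (ler_normD _ _))//.
by rewrite (le_trans _ nm)// addrC lerD// (le_trans (H2 x)).
Qed.

(** It supplies one step [h] whose error in [slope_rate_ge] is small at all times of a compact
    interval. *)
Lemma locally_equicontinuous_derive1 u a b e : C1_flow u -> 0 <= a -> 0 < e ->
  exists2 d : R, 0 < d & forall t, a <= t <= b -> forall x y, `|y - x| < d ->
    `|derive1 (u t) y - derive1 (u t) x| <= e.
Proof.
move=> [C1u peru contu] a0 e0; have e3 : 0 < e / 3 by rewrite divr_gt0.
pose Q n t := forall x y, `|y - x| * n < 1 ->
  `|derive1 (u t) y - derive1 (u t) x| <= e.
have [n Hn] : exists n, forall t, a <= t <= b -> Q n t.
  apply: locally_uniform_segment => t /andP[at_ _].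
  have t0 := le_trans a0 at_.
  have [d1 d10 H1] := periodic_uniformly_continuous (C1u _ t0).2
    (periodic_derive1 (peru _ t0) (C1u _ t0)) e3.
  have [d d0 Hd] := contu _ _ t0 e3.
  exists d => //; exists d1^-1 => m r nm /andP[ar _] rt x y xy.
  have yx : `|y - x| < d1.
    rewrite -(invrK d1) -[_^-1]mul1r ltr_pdivlMr ?invr_gt0//.
    by apply: le_lt_trans xy; rewrite ler_wpM2l.
  have [_ h1] := Hd r (le_trans a0 ar) rt x.
  have [_ h2] := Hd r (le_trans a0 ar) rt y.
  have h3 := H1 x y yx.
  move: h1 h2 h3; rewrite !ler_norml => /andP[? ?] /andP[? ?] /andP[? ?].
  by apply/andP; split; lra.
exists (Num.max n 1)^-1; first by rewrite invr_gt0 lt_max ltr01 orbT.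
move=> t tab x y yx; apply: Hn => //.
apply: (@le_lt_trans _ _ (`|y - x| * Num.max n 1)).
  by rewrite ler_wpM2l// le_max lexx.
by rewrite -ltr_pdivlMr ?mul1r// lt_max ltr01 orbT.
Qed.

End Descent.

(** * Riccati barrier and blow-up *)

Section Riccati.
Context {R : realType}.
Implicit Types (u : R -> R -> R) (f G P K : R -> R) (x y z e t r v h M C a : R).

(** The barrier solves [psi' = psi ^+ 2 / 2], starts from [a] at [t1] and blows up at [t1 + 2 / a].
    The factor [1 / 2] leaves room for the error due to the finite step [h]. *)
Lemma derive_riccati_barrier a t1 r : 0 < a -> r < t1 + 2 / a ->
  0 < a^-1 - (r - t1) / 2 /\
  is_derive r 1 (fun r => (a^-1 - (r - t1) / 2)^-1) ((a^-1 - (r - t1) / 2)^-1 ^+ 2 / 2).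
Proof.
move=> a0 rt.
have p0 : 0 < a^-1 - (r - t1) / 2 by move: rt; clear; lra.
split=> //.
have d0 : is_derive r 1 (fun r => a^-1 - (r - t1) * 2^-1) (0 - ((1 - 0) * 2^-1 + (r - t1) * 0)).
  exact: is_derive_sub (is_derive_const _ r)
    (is_derive_mul (is_derive_sub (is_derive_var r) (is_derive_const t1 r)) (is_derive_const 2^-1 r)).
have := @is_deriveV _ (fun r => a^-1 - (r - t1) * 2^-1) r _ 1 (lt0r_neq0 p0) d0.
congr (is_derive _ _ _ _); rewrite /GRing.scale/=; field.
have an0 := lt0r_neq0 a0; rewrite an0 /=.
have -> : 2 + - (r - t1) * a = 2 * a * (a^-1 - (r - t1) / 2) by field.
by rewrite !mulf_neq0// lt0r_neq0.
Qed.

(** The rest of the argument uses only these properties, without Sobolev spaces. [C] does not depend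
    on time, so that [h] can be chosen uniformly. *)
Definition DP_flow C u : Prop := [/\ C1_flow u, 0 <= C &
  forall t, 0 < t -> exists P K, uniform_time_derivative u C t P K].

(** Both ends of [[x, x + h]] move with velocity [u t x], which removes the transport term at the
    left end. The defect then grows faster than the barrier, so it stays above it for a short
    time. *)
Lemma slope_defect_step u C a h t x M (eta : R) t1 :
  DP_flow C u -> 0 < a -> 0 < t -> t1 <= t < t1 + 2 / a -> 0 < h ->
  (forall y, `|u t y| <= M) -> (forall y, `|derive1 (u t) y| <= M) ->
  (forall y z, `|z - y| <= h -> `|derive1 (u t) z - derive1 (u t) y| <= eta) ->
  M * eta + h * (M ^+ 2 * (C + 3)) <= a ^+ 2 / 4 ->
  (a^-1 - (t - t1) / 2)^-1 <= - ((u t (x + h) - u t x) / h) - 2 * `|u t x| ->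
  exists2 d : R, 0 < d & forall r, t < r < t + d -> exists y,
    (a^-1 - (r - t1) / 2)^-1 <= - ((u r (y + h) - u r y) / h) - 2 * `|u r y|.
Proof.
move=> [[C1u peru contu] C0 utu] a0 t0 /andP[t1t tt1] h0 uM duM Heta err Wt.
have [P [K utK]] := utu _ t0.
have cu := C1u _ (ltW t0).
set v := u t x.
have dl := is_derive_along x v t0 cu utK.
have dr := is_derive_along (x + h) v t0 cu utK.
have [p0 dpsi] := derive_riccati_barrier a0 tt1.
have rate := slope_rate_ge cu C0 utK.1 h0 uM duM Heta (erefl ((u t (x + h) - u t x) / h)).
move: Wt rate dpsi; set psi := _^-1; set q := (u t (x + h) - u t x) / h => Wt rate dpsi.
have psia : a <= psi.
  rewrite -[leLHS]invrK lef_pV2 ?posrE ?invr_gt0//.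
  by move: t1t; clear; lra.
have [[_ _ _ _] [KP _]] := utK.1.
have KPx := KP x.
(* The nonsmooth [- 2 * |u|] is the minimum of [2 * sg * u] over the two signs; each sign gives a
   differentiable function. *)
have key (sg : R) : `|sg| = 1 -> exists2 d : R, 0 < d & forall r, t < r < t + d ->
    0 <= - ((u r (x + h + (r - t) * v) - u r (x + (r - t) * v)) * h^-1)
      + 2 * sg * u r (x + (r - t) * v) - (a^-1 - (r - t1) / 2)^-1.
  move=> sg1.
  pose df := - (((v - u t (x + h)) * derive1 (u t) (x + h) - K (x + h)
     - ((v - u t x) * derive1 (u t) x - K x)) * h^-1 +
     (u t (x + h + (t - t) * v) - u t (x + (t - t) * v)) * 0)
     + 2 * sg * ((v - u t x) * derive1 (u t) x - K x) - psi ^+ 2 / 2.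
  have D := is_derive_sub (is_derive_add (is_derive_opp (is_derive_mul (is_derive_sub dr dl) (is_derive_const h^-1 t)))
      (is_derive_scale (2 * sg) dl)) dpsi.
  rewrite -/df in D; apply: (derive_gt0_right D) => {D}.
  - rewrite !subrr !mul0r !addr0 -/q -/psi.
    have : - (sg * u t x) <= `|u t x|.
      by rewrite -[`|u t x|]mul1r -sg1 -normrM -normrN ler_norm.
    by move: Wt; clear; lra.
  - have -> : df = q * derive1 (u t) (x + h) + (K (x + h) - K x) / h
        - 2 * (sg * K x) - psi ^+ 2 / 2.
      by rewrite /df /q -/v subrr; field; rewrite gt_eqF.
    have sK : sg * K x <= `|K x|.
      by rewrite -[`|K x|]mul1r -sg1 -normrM ler_norm.
    have q2 : psi ^+ 2 + 4 * u t x ^+ 2 <= q ^+ 2.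
      have : psi + 2 * `|u t x| <= - q by move: Wt; clear; lra.
      rewrite -(real_normK (num_real (u t x))) -(sqrrN q).
      have := normr_ge0 (u t x); move: (`|u t x|) => w w0 hq.
      have ps0 : 0 <= psi by apply: le_trans psia; exact: ltW.
      apply: (@le_trans _ _ ((psi + 2 * w) ^+ 2)).
        by move: ps0 w0; clear; nra.
      by rewrite ler_sqr ?nnegrE//; move: ps0 w0 hq; clear; lra.
    have a2 : a ^+ 2 <= psi ^+ 2.
      by rewrite ler_sqr ?nnegrE ?(ltW a0)// (le_trans _ psia)// ltW.
    have a20 : 0 < a ^+ 2 by rewrite exprn_gt0.
    have u2 : 0 <= u t x ^+ 2 by exact: sqr_ge0.
    (* The term [P] from [rate] absorbs [2 * sg * K], and [4 * u ^+ 2] from [q2] absorbs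
       [3 / 2 * u ^+ 2]. What remains is at least [psi ^+ 2 / 2 - a ^+ 2 / 4 > 0]. *)
    by move: rate err q2 sK KPx a2 a20 u2; clear; lra.
have [d1 d10 H1] := key 1 (normr1 R).
have [d2 d20 H2] := key (-1) (normrN1 R).
exists (Num.min d1 d2); first by rewrite lt_min d10 d20.
move=> r rt; exists (x + (r - t) * v).
have r1 : t < r < t + d1.
  by case/andP: rt => -> /lt_le_trans; apply; rewrite lerD2l ge_min lexx.
have r2 : t < r < t + d2.
  by case/andP: rt => -> /lt_le_trans; apply; rewrite lerD2l ge_min lexx orbT.
have := H1 r r1; have := H2 r r2.
rewrite (addrAC x h); move: ((a^-1 - (r - t1) / 2)^-1) (_ * h^-1) => ps Q.
by case: (ger0P (u r _)) => _; lra.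
Qed.

(** Otherwise some point always keeps the defect [W] above the barrier, which exceeds the bound [M]
    of [W] on the compact interval before blowing up. *)
Lemma slope_lower_bound_pos u C t x : DP_flow C u -> 0 < t -> - 2 * `|u t x| <= derive1 (u t) x.
Proof.
move=> hu; have [hf C0 _] := hu; have [C1u peru contu] := hf.
move=> t0; rewrite leNgt; apply/negP => steep.
set t1 := t in steep t0 *.
set A := - derive1 (u t) x - 2 * `|u t x|.
have A0 : 0 < A by move: steep; rewrite /A; clear; lra.
(* The other half of [A] pays for replacing the derivative by a difference quotient. *)
set a := A / 2; have a0 : 0 < a by rewrite divr_gt0.
have [M HM] := locally_bounded_C1 (t1 + 2 / a) hf (ltW t0).
have Ta : 0 < 2 / a by rewrite divr_gt0.
have t1T : t1 <= t1 <= t1 + 2 / a by rewrite lexx lerDl ltW.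
have M0 : 0 <= M by apply: le_trans (HM t1 t1T x).1.
(* [eta] and later [h] each account for half of the allowed error [a ^+ 2 / 4]; the added 1 in
   [M + 1] and in [N] keeps the denominators positive. *)
pose eta := a ^+ 2 / 8 / (M + 1).
have M1 : 0 < M + 1 by rewrite ltr_wpDl.
have eta0 : 0 < eta by rewrite divr_gt0// divr_gt0// exprn_gt0.
have [d d0 Hd] := locally_equicontinuous_derive1 (t1 + 2 / a) hf (ltW t0) eta0.
have dx := C1fun_is_derive x (C1u _ (ltW t0)).
have /is_derive_distP/(_ _ a0)[d' d'0 Hd'] := dx.
pose N := M ^+ 2 * (C + 3) + 1.
have N0 : 0 < N by rewrite ltr_wpDl// mulr_ge0 ?sqr_ge0//; move: C0; clear; lra.
pose h := Num.min (Num.min (d / 2) (d' / 2)) (a ^+ 2 / 8 / N).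
have h0 : 0 < h by rewrite !lt_min !divr_gt0// exprn_gt0.
have hd : h < d.
  by apply: (@le_lt_trans _ _ (d / 2)); [rewrite !ge_min lexx|move: d0; clear; lra].
have hd' : h < d'.
  apply: (@le_lt_trans _ _ (d' / 2)); last by move: d'0; clear; lra.
  by rewrite !ge_min lexx orbT.
have hN : h * N <= a ^+ 2 / 8 by rewrite -ler_pdivlMr// !ge_min lexx !orbT.
have err : M * eta + h * (M ^+ 2 * (C + 3)) <= a ^+ 2 / 4.
  have e1 : M * eta <= a ^+ 2 / 8.
    rewrite /eta mulrCA ler_piMr ?divr_ge0 ?sqr_ge0//.
    by rewrite ler_pdivrMr// mul1r lerDl.
  have : h * (M ^+ 2 * (C + 3)) <= h * N by rewrite ler_wpM2l ?(ltW h0)// lerDl.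
  by move: e1 hN; clear; lra.
pose W r y := - ((u r (y + h) - u r y) / h) - 2 * `|u r y|.
pose psi r := (a^-1 - (r - t1) / 2)^-1.
have W1 : a <= W t1 x.
  have := Hd' (x + h); rewrite addrAC subrr add0r (gtr0_norm h0) => /(_ hd').
  rewrite -ler_pdivrMr// -[X in _ / X](gtr0_norm h0) -normfV -normrM mulrBl mulfK ?gt_eqF//.
  rewrite ler_norml => /andP[_].
  by rewrite /W -/t1 /a /A; clear; lra.
have WM r y : t1 <= r <= t1 + 2 / a -> W r y <= M.
  move=> rT; have r0 : 0 <= r by case/andP: rT => h1 _; exact: le_trans (ltW t0) h1.
  have yh : y < y + h by rewrite ltrDl.
  have [c _ e] := derive_mvt yh (fun z _ => C1fun_is_derive z (C1u _ r0)).
  have -> : W r y = - derive1 (u r) c - 2 * `|u r y|.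
    by rewrite /W e; field; rewrite gt_eqF.
  have := (HM r rT c).2; rewrite ler_norml => /andP[+ _].
  by have := normr_ge0 (u r y); clear; lra.
have aM : a <= M by apply: le_trans (WM t1 x t1T).
(* The time at which the barrier equals [M + 1]. *)
pose T := t1 + 2 / a - 2 / (M + 1).
have TT : T < t1 + 2 / a by rewrite gtrBl divr_gt0.
have t1T' : t1 <= T.
  rewrite /T -addrA lerDl subr_ge0 ler_wpM2l// lef_pV2 ?posrE//.
  by apply: (le_trans aM); rewrite lerDl.
have Wcont r : 0 <= r -> continuous (W r).
  move=> r0; have cr := C1fun_continuous (C1u _ r0).
  apply: continuous_sub; last by apply: continuous_mul; [exact: continuous_const|exact: continuous_abs].
  apply: continuous_opp; apply: continuous_mul; last exact: continuous_const.
  apply: continuous_sub => //; apply: continuous_compose => //.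
  by apply: continuous_add; [exact: continuous_var|exact: continuous_const].
have Wper r : 0 <= r -> periodic1 (W r).
  by move=> r0 y; rewrite /W addrAC !peru.
(* The induction propagates the existence of a good point, not a trajectory. At a left limit, the
   maximum of [W r] over a period replaces a limit of points. *)
have step : forall r, t1 <= r <= T -> exists y, psi r <= W r y.
  apply: real_induction.
  - by exists x; rewrite /psi subrr mul0r subr0 invrK.
  - move=> r /andP[t1r rT] [y Wy].
    have rT' : t1 <= r < t1 + 2 / a by rewrite t1r (lt_trans rT).
    have rT'' : t1 <= r <= t1 + 2 / a by case/andP: rT' => -> /ltW ->.
    have r0 : 0 < r by exact: lt_le_trans t1r.
    apply: (slope_defect_step hu a0 r0 rT' h0 _ _ _ err Wy).
    + by move=> z; exact: (HM r rT'' z).1.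
    + by move=> z; exact: (HM r rT'' z).2.
    + by move=> z w zw; apply: Hd => //; exact: le_lt_trans zw hd.
  - move=> r /andP[t1r rT] IH; apply: contrapT => nW.
    have r0 : 0 <= r by apply: ltW; exact: lt_trans t1r.
    have [y _ Hy] := EVT_max (@ler01 R) (continuous_subspaceT (Wcont r r0)).
    have {}Hy z : W r z <= W r y.
      rewrite -(periodic1_floor z (Wper r r0)); apply: Hy.
      rewrite in_itv/= subr_ge0 ge_floor/= lerBlDl.
      by have := lt_succ_floor z; rewrite intrD => /ltW.
    have gap : 0 < psi r - W r y.
      by rewrite subr_gt0 ltNge; apply/negP => Wy; apply: nW; exists y.
    have k0 : 0 < 2 / h + 2 by rewrite addr_gt0// divr_gt0.
    (* A change of [u] by [e] changes [W] by at most [2 * e / h + 2 * e], which is a third of the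
       gap; the barrier takes another third. *)
    pose e := (psi r - W r y) / 3 / (2 / h + 2).
    have e0 : 0 < e by rewrite !divr_gt0.
    have [d1 d10 H1] := contu _ _ r0 e0.
    have g3 : 0 < (psi r - W r y) / 3 by rewrite divr_gt0.
    have rT' : r < t1 + 2 / a by exact: le_lt_trans TT.
    have [d2 d20 H2] := continuous_dist
      (is_derive_continuous (derive_riccati_barrier a0 rT').2) g3.
    pose m := Num.min d1 d2.
    have m0 : 0 < m by rewrite lt_min d10 d20.
    pose z := Num.max t1 (r - m / 2).
    have zr : z < r by rewrite gt_max t1r gtrBl divr_gt0.
    have t1z : t1 <= z by rewrite le_max lexx.
    have zm : `|z - r| < m.
      rewrite distrC gtr0_norm ?subr_gt0// ltrBlDr -ltrBlDl.
      rewrite lt_max; apply/orP; right; rewrite ltrD2l ltrN2.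
      by move: m0; clear; lra.
    have [w Ww] := IH z (introT andP (conj t1z zr)).
    have z0 : 0 <= z by exact: le_trans (ltW t0) t1z.
    have zd1 : `|z - r| < d1 by apply: (lt_le_trans zm); rewrite ge_min lexx.
    have zd2 : `|z - r| < d2 by apply: (lt_le_trans zm); rewrite ge_min lexx orbT.
    have [h1 _] := H1 z z0 zd1 w; have [h2 _] := H1 z z0 zd1 (w + h).
    have h3 := ltW (H2 z zd2).
    have dW : `|W z w - W r w| <= (psi r - W r y) / 3.
      have -> : (psi r - W r y) / 3 = e / h + e / h + 2 * e.
        by rewrite -[LHS](divfK (lt0r_neq0 k0)) -/e; ring.
      rewrite (_ : W z w - W r w = - ((u z (w + h) - u r (w + h)) / h)
         + (u z w - u r w) / h - 2 * (`|u z w| - `|u r w|)); last by rewrite /W; ring.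
      rewrite (le_trans (ler_normB _ _))// lerD//.
        rewrite (le_trans (ler_normD _ _))// normrN !normrM normfV (gtr0_norm h0).
        by rewrite lerD// ler_wpM2r// invr_ge0 ltW.
      rewrite normrM ger0_norm// ler_wpM2l//.
      by apply: le_trans h1; exact: ler_dist_dist.
    have := Hy w; move: dW h3 Ww gap; rewrite -/(psi z) -/(psi r) !ler_norml.
    by move=> /andP[_ ?] /andP[? _] ? ? ?; lra.
have TT' : t1 <= T <= T by rewrite t1T' lexx.
have [y Wy] := step T TT'.
have TT2 : t1 <= T <= t1 + 2 / a by rewrite t1T' ltW.
have := le_trans Wy (WM T y TT2).
have -> : psi T = M + 1.
  rewrite /psi (_ : _ - _ = (M + 1)^-1) ?invrK//.
  by rewrite /T; field; rewrite !gt_eqF.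
by rewrite leNgt ltrDl ltr01.
Qed.

(** The equation holds for positive times only; time 0 is reached by continuity in C^1. *)
Lemma slope_lower_bound u C t x : DP_flow C u -> 0 <= t -> - 2 * `|u t x| <= derive1 (u t) x.
Proof.
move=> hu; have [[_ _ contu] _ _] := hu.
rewrite le_eqVlt => /orP[/eqP<-|]; last exact: slope_lower_bound_pos hu.
apply/ler_addgt0Pr => e e0; have e3 : 0 < e / 3 by rewrite divr_gt0.
have [d d0 Hd] := contu _ _ (lexx 0) e3.
have d2 : 0 < d / 2 by rewrite divr_gt0.
have := Hd (d / 2) (ltW d2); rewrite subr0 (gtr0_norm d2) => /(_ _ x)[|h1 h2].
  by move: d0; clear; lra.
have h3 := slope_lower_bound_pos x hu d2.
have h4 := le_trans (ler_dist_dist _ _) h1.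
by move: h2 h3 h4; rewrite !ler_norml => /andP[? ?] ? /andP[? ?]; lra.
Qed.

End Riccati.

(** * Vanishing *)

Section Conclusion.
Context {R : realType}.
Implicit Types (u : R -> R -> R) (f g : R -> R) (x y e t r C a b : R).
Local Notation mu := (@lebesgue_measure R).

(** Real induction: a positive value persists by continuity, a zero is left upwards, and a negative
    value would already be negative slightly earlier. *)
Lemma ge0_barrier g (dg : R -> R) a : (forall x, is_derive x 1 g (dg x)) -> 0 <= g a ->
  (forall x, a <= x -> g x = 0 -> 0 < dg x) -> forall x, a <= x -> 0 <= g x.
Proof.
move=> dG ga dg0 b ab.
have cg x : {for x, continuous g} by exact: is_derive_continuous (dG x).
suff H : forall t, a <= t <= b -> 0 <= g t by apply: H; rewrite ab lexx.
apply: real_induction => // [t /andP[at_ tb] gt0|t /andP[at_ tb] IH].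
  have [g0|gn0] := eqVneq (g t) 0.
    by apply: (derive_gt0_right (dG t)) => //; exact: dg0.
  have {}gt0 : 0 < g t by rewrite lt_neqAle eq_sym gn0.
  have [d d0 Hd] := continuous_dist (cg t) gt0.
  exists d => // r rt; have : `|g r - g t| < g t.
    by apply: Hd; rewrite ger0_norm; move: rt; clear; lra.
  by rewrite ltr_norml => /andP[+ _]; lra.
rewrite leNgt; apply/negP => gt0.
have ng0 : 0 < - g t by rewrite oppr_gt0.
have [d d0 Hd] := continuous_dist (cg t) ng0.
pose r := Num.max a (t - d / 2).
have rt : r < t by rewrite gt_max at_ gtrBl divr_gt0.
have ar : a <= r by rewrite le_max lexx.
have := IH r (introT andP (conj ar rt)).
have : `|g r - g t| < - g t.
  apply: Hd; rewrite distrC gtr0_norm ?subr_gt0// ltrBlDr -ltrBlDl.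
  by rewrite lt_max; apply/orP; right; rewrite ltrD2l ltrN2; move: d0; clear; lra.
by rewrite ltr_norml => /andP[_]; lra.
Qed.

Lemma periodic_slope_zero f x0 : C1fun f -> periodic1 f ->
  (forall x, - 2 * `|f x| <= derive1 f x) -> f x0 = 0 -> forall x, f x = 0.
Proof.
move=> cf pf slope f0.
have right_ge0 x : x0 <= x -> 0 <= f x.
  move=> x0x; apply/ler_addgt0Pr => e e0.
  (* The perturbation [c * expR (3 * (y - x0))] equals [e] at [y = x]. Its rate 3 exceeds 2, so at a
     zero of the perturbed function the derivative is strictly positive. *)
  pose c := e * expR (- (3 * (x - x0))).
  have c0 : 0 < c by rewrite mulr_gt0// expR_gt0.
  have dE y : is_derive y 1 (fun y => f y + c * expR (3 * (y - x0)))
      (derive1 f y + c * (expR (3 * (y - x0)) * (3 * (1 - 0)))).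
    exact: is_derive_add (C1fun_is_derive y cf) (is_derive_scale c (is_derive_compose
      (is_derive_scale 3 (is_derive_sub (is_derive_var y) (is_derive_const x0 y))) (is_derive_expR _))).
  have cE : c * expR (3 * (x - x0)) = e by rewrite /c -mulrA -expRD addNr expR0 mulr1.
  have := @ge0_barrier _ _ x0 dE _ _ x x0x; rewrite cE; apply.
    by rewrite f0 subrr mulr0 expR0 add0r mulr1 ltW.
  move=> y _ gy.
  have E0 : 0 < c * expR (3 * (y - x0)) by rewrite mulr_gt0// expR_gt0.
  have fy : f y = - (c * expR (3 * (y - x0))) by move: gy; clear; lra.
  have := slope y; rewrite fy normrN (gtr0_norm E0).
  by move: E0; rewrite subr0 mulr1 mulrA; clear; lra.
(* Every point has a translate to the right of [x0]. *)
have f_ge0 x : 0 <= f x.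
  rewrite -(periodic1_shift x (Num.floor (x0 - x) + 1) pf); apply: right_ge0.
  by rewrite -lerBlDl ltW// lt_succ_floor.
have mono x y : x <= y -> expR (2 * x) * f x <= expR (2 * y) * f y.
  move=> xy.
  apply: (@derive_ge0_le R (fun z => expR (2 * z) * f z) (fun z =>
    expR (2 * z) * (2 * 1) * f z + expR (2 * z) * derive1 f z) _ _ xy) => z _.
    exact: is_derive_mul (is_derive_compose (is_derive_scale 2 (is_derive_var z)) (is_derive_expR _))
      (C1fun_is_derive z cf).
  rewrite mulr1 -mulrA -mulrDr mulr_ge0 ?expR_ge0//.
  by have := slope z; rewrite ger0_norm ?f_ge0//; lra.
move=> x; apply/eqP; rewrite eq_le f_ge0 andbT.
(* The translate lies to the left of [x0 + 1], where [f] vanishes, and [mono] then gives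
   [f <= 0]. *)
rewrite -(periodic1_shift x (- Num.floor (x - x0)) pf) mulrNz.
set y := x - (Num.floor (x - x0))%:~R.
have yx : y <= x0 + 1.
  by rewrite /y; have := lt_succ_floor (x - x0); rewrite intrD; clear; lra.
have := mono y (x0 + 1) yx; rewrite pf f0 mulr0.
by rewrite pmulr_rle0// expR_gt0.
Qed.

(** The time derivative is the space derivative of the periodic function [- u ^+ 2 / 2 - P], so its
    integral is 0; uniformity in [x] lets it pass under the integral. The reference time 1 is
    positive, and time 0 follows by continuity. *)
Lemma mean_constant u C : DP_flow C u -> forall t, 0 <= t ->
  \int[mu]_(x in `[0, 1]) u t x = \int[mu]_(x in `[0, 1]) u 1 x.
Proof.
move=> [[C1u peru contu] _ utu].
pose m t := \int[mu]_(x in `[0, 1]) u t x; rewrite -/(m 1).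
have cu t : 0 <= t -> continuous (u t) by move=> t0; exact: C1fun_continuous (C1u t t0).
have bound f e : continuous f -> (forall x, `|f x| <= e) ->
    `|\int[mu]_(x in `[0, 1]) f x| <= e.
  move=> cf fe; apply: (le_trans (Rintegral_itv_norm _ _ cf)).
  rewrite -[leRHS]Rintegral01_const; apply: Rintegral_itv_le => //; first exact: continuous_abs.
  exact: continuous_const.
have dm t : 0 < t -> is_derive t 1 m 0.
  move=> t0; have [P [K [[[pP _ dP dK] _] H]]] := utu t t0.
  apply/is_derive_distP => e e0; have [d d0 Hd] := H e e0.
  exists (Num.min t d); first by rewrite lt_min t0.
  move=> r; rewrite lt_min => /andP[rt rd].
  have r0 : 0 <= r by move: rt; rewrite ltr_norml => /andP[+ _]; clear; lra.
  have ct := cu t (ltW t0); have cr := cu r r0.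
  have cK : continuous K by move=> x; exact: is_derive_continuous (dK x).
  set g := fun x => - (u t x * derive1 (u t) x) - K x.
  have cg : continuous g.
    by apply: continuous_sub => //; apply: continuous_opp; apply: continuous_mul => //; exact: (C1u t (ltW t0)).2.
  have g0 : \int[mu]_(x in `[0, 1]) g x = 0.
    have dG x : is_derive x 1 (fun x => - (2^-1 * (u t x * u t x)) - P x) (g x).
      have hu := C1fun_is_derive x (C1u t (ltW t0)).
      have := is_derive_sub (is_derive_opp (is_derive_scale 2^-1 (is_derive_mul hu hu))) (dP x).
      by congr (is_derive _ _ _ _); rewrite /g; field.
    rewrite (Rintegral_FTC (@ler01 R) cg dG) -[1]add0r pP.
    by rewrite (peru t (ltW t0)) subrr.
  have cg' : continuous (fun x => (r - t) * g x) by apply: continuous_mul => //; exact: continuous_const.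
  rewrite mul0r subr0 (_ : m r - m t = \int[mu]_(x in `[0, 1])
      (u r x - u t x - (r - t) * g x)); last first.
    rewrite Rintegral_itv_sub//; last exact: continuous_sub.
    by rewrite Rintegral_itv_sub// (Rintegral_itv_scale _ _ _ cg) g0 mulr0 subr0.
  by apply: bound => //; [apply: continuous_sub => //; exact: continuous_sub|move=> x; exact: Hd].
have m1 a b : 0 < a -> a < b -> m b = m a.
  move=> a0 ab; have [|c _] := @derive_mvt R m (fun=> 0) a b ab.
    by move=> x /andP[ax _]; apply: dm; exact: lt_le_trans ax.
  by rewrite mul0r => /eqP; rewrite subr_eq0 => /eqP.
have mpos t : 0 < t -> m t = m 1.
  by move=> t0; have [t1|t1|->//] := ltgtP t 1; [rewrite (m1 t 1)|rewrite (m1 1 t)].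
move=> t; rewrite le_eqVlt => /orP[/eqP<-|]; last exact: mpos.
rewrite -/(m 0); apply/eqP; rewrite -subr_eq0 -normr_le0; apply/ler_addgt0Pr => e e0.
rewrite add0r; have [d d0 Hd] := contu 0 e (lexx 0) e0.
have d2 : 0 < d / 2 by rewrite divr_gt0.
rewrite -(mpos _ d2) distrC /m -Rintegral_itv_sub; [|exact: cu (ltW d2)|exact: cu (lexx 0)].
apply: bound; first by apply: continuous_sub; [exact: cu (ltW d2)|exact: cu (lexx 0)].
move=> x; have [] // := Hd (d / 2) (ltW d2) _ x.
by rewrite subr0 (gtr0_norm d2); move: d0; clear; lra.
Qed.

Lemma DP_flow_zero u C t0 x0 : DP_flow C u -> 0 <= t0 -> u t0 x0 = 0 ->
  forall t x, 0 <= t -> u t x = 0.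
Proof.
move=> hu t00 u0 t x t_ge0.
have [[C1u peru _] _ _] := hu.
have zero r y : 0 <= r -> u r y = 0 -> forall z, u r z = 0.
  move=> r0; apply: periodic_slope_zero; [exact: C1u|exact: peru|].
  by move=> z; exact: slope_lower_bound hu r0.
have mt : \int[mu]_(y in `[0, 1]) u t y = 0.
  rewrite (mean_constant hu t_ge0) -(mean_constant hu t00).
  rewrite (_ : u t0 = fun=> 0); first exact: Rintegral01_const.
  by apply/funext => y; exact: zero u0 y.
have ct : continuous (u t) by exact: C1fun_continuous (C1u t t_ge0).
(* The mean value theorem for a primitive gives a point where [u t] equals its mean 0. *)
have [F dF] := primitive_exists ct.
have [c _] := derive_mvt (@ltr01 R) (fun y _ => dF y).
rewrite -(Rintegral_FTC (@ler01 R) ct dF) mt subr0 mulr1 => /esym uc.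
exact: zero uc x.
Qed.

(** The equation itself supplies the continuous representative of [ut t], the convolution being the
    differentiable [K]. *)
Lemma DP_global_solution_flow s u : 3 / 2 < s -> DP_global_solution s u ->
  exists C, DP_flow C u.
Proof.
move=> hs [su C1u [ut [sut dut eqn]]].
have [C C0 HC] := @convolution_derive_kernel R.
have peru t : 0 <= t -> periodic1 (u t) by move=> t0; have [[]] := su.1 t t0.
exists C; split=> //.
  by split=> // t e t0 e0; exact: (C0_sobolev_uniform_C1 hs su C1u t0 e0).
move=> t t0; have ct := C1fun_continuous (C1u t (ltW t0)).
have pt := peru t (ltW t0).
pose G x := 3 / 2 * u t x ^+ 2.
have cG : continuous G by apply: continuous_mul; [exact: continuous_const|exact: continuous_pow].
have pG : periodic1 G by move=> x; rewrite /G pt.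
have G0 x : 0 <= G x by rewrite mulr_ge0// sqr_ge0.
have [P [K [pPK HK]]] := HC G cG pG G0.
exists P, K; split=> // e e0.
have [[_ pK _ dK] _] := pPK.
have pdu := periodic_derive1 pt (C1u t (ltW t0)).
apply: (sobolev_time_derivative_uniform hs su C1u sut dut (ltW t0) _ _ _ e0).
- apply: continuous_sub; last by move=> x; exact: is_derive_continuous (dK x).
  by apply: continuous_opp; apply: continuous_mul => //; exact: (C1u t (ltW t0)).2.
- by move=> x; rewrite pt pdu pK.
- case: (eqn t t0) => N [mN N0 sN]; exists N; split=> // x nx; apply: sN => /= ex.
  by apply: nx; rewrite /= -HK; move: ex; rewrite -/G; lra.
Qed.

End Conclusion.

Unset Implicit Arguments.

Theorem theorem1p1 (R : realType) (s : R) (u : R -> R -> R)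
    (hs : 3 / 2 < s) (hu : DP_global_solution s u) :
  (exists t0 x0 : R, 0 <= t0 /\ u t0 x0 = 0) ->
  forall t x : R, 0 <= t -> u t x = 0.
Proof.
move=> [t0 [x0 [t00 u0]]] t x t_ge0.
have [C hC] := DP_global_solution_flow hs hu.
exact: DP_flow_zero hC t00 u0 t x t_ge0.
Qed.
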